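(* Let $b,c\in\mathbb{R}$ and let $\{H_m(z)\}_{m\ge0}$ be the sequence of polynomials in $z$ defined by $H_0(z)=1$, $H_1(z)=-c$, $H_2(z)=-b+c^2$ and \[ H_m(z)+cH_{m-1}(z)+bH_{m-2}(z)+zH_{m-3}(z)=0,\qquad m\ge3. \] Then the zeros of $H_m(z)$ are real for all $m$ if and only if one of the following holds: (i) $c=0$ and $b\ge0$; (ii) $c\neq0$ and $-1\le b/c^2\le 1/3$. Moreover, in case (i) with $b>0$, the set $\bigcup_{m=0}^{\infty}\mathcal{Z}(H_m)$ is dense in $(-\infty,\infty)$. In case (ii), $\bigcup_{m=0}^{\infty}\mathcal{Z}(H_m)$ is dense in the set \[ \left\{c^3x:\ x\in\left(-\infty,\ \frac{-2+9b/c^2-2\sqrt{(1-3b/c^2)^3}}{27}\right]\right\}. \]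
   Context: $\mathcal{Z}(H_m)$ denotes the set of zeros of the polynomial $H_m(z)$. Convention: the zeros of the constant zero polynomial are considered real. *)

(* Defs.v *)
From HB Require Import structures.
From mathcomp Require Import all_boot all_order all_algebra.
From mathcomp Require Import complex.
From mathcomp Require Import all_classical all_reals all_analysis.
Set Implicit Arguments. Unset Strict Implicit. Unset Printing Implicit Defensive.
Import Order.TTheory GRing.Theory Num.Theory.
Local Open Scope ring_scope.

Fixpoint H (R : realType) (b c : R) (m : nat) : {poly R} :=
  match m with
  | 0 => 1
  | 1 => (- c)%:P
  | 2 => (- b + c ^+ 2)%:P
  | S ((S ((S k) as k1)) as k2) =>
      - (c *: H b c k2) - (b *: H b c k1) - 'X * H b c k
  end.

(* The zeros of H_m are real: every complex zero of H_m (viewed in R[i]) has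
   imaginary part 0; by convention the zeros of the zero polynomial are real. *)
Definition zeros_real (R : realType) (p : {poly R}) : Prop :=
  p != 0 ->
  forall z : R[i], root (map_poly (real_complex R) p) z -> complex.Im z = 0.

Definition union_zeros (R : realType) (b c : R) : set R :=
  [set x | exists m : nat, H b c m != 0 /\ root (H b c m) x].

(* Main.v *)
Require Import Defs.
From HB Require Import structures.
From mathcomp Require Import all_boot all_order all_algebra.
From mathcomp Require Import complex.
From mathcomp Require Import all_classical all_reals all_analysis.
From mathcomp Require Import polyrcf ring lra zify.
Import Order.TTheory GRing.Theory Num.Theory.
Import numFieldNormedType.Exports.
Local Open Scope classical_set_scope.
Local Open Scope ring_scope.

(* H_m(z) is the complete homogeneous symmetric polynomial h_m in the roots
   s1, s2, s3 of F(s) = s^3 + c s^2 + b s + z, that is, the sum of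
   s_j^(m+2) / F'(s_j).

   Sufficiency and density: for real z with roots s, t e^(i th), t e^(-i th) and
   |s| < t, at the angles th = k pi / (m+2) the sign of H_m(z) is (-1)^(k+1).
   In the stated parameter ranges z is a strictly monotone function of th, on
   (pi/3, 2 pi/3) if c = 0 and on (2 pi/3, pi) if c = 1 (to which c <> 0 reduces
   by scaling), so sign changes, together with the sign at -oo when c = 1, give
   all zeros of H_m up to degree reasons. The endpoint of the interval is the
   value of z where the pair merges into a double root.

   Necessity: outside these ranges there is a nonreal z for which two roots
   s1, s2 have the same modulus M and dominate s3. If all zeros of H_m are real,
   (log H_m)'' is O(m) at z. But differentiating the closed form in z shows that
   H_m'' H_m - (H_m')^2 = m^2 (C (s1 s2)^m + o(M^(2m))) with C <> 0, whereas
   H_m^2 = O(M^(2m)): a contradiction for large m. *)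

(** * Recurrence, degree, scaling and closed form of [H] *)

Lemma H_rec (R : realType) (b c : R) (m : nat) :
  H b c m.+3 = - (c *: H b c m.+2) - (b *: H b c m.+1) - 'X * H b c m.
Proof. by []. Qed.

Lemma nat_ind3 (P : nat -> Prop) :
  P 0%N -> P 1%N -> P 2%N -> (forall m, P m -> P m.+1 -> P m.+2 -> P m.+3) ->
  forall m, P m.
Proof.
move=> P0 P1 P2 PS m.
suff [] : [/\ P m, P m.+1 & P m.+2] by [].
elim: m => [//|m [Pm Pm1 Pm2]]; split=> //; exact: PS.
Qed.

Lemma horner_H_rec (R : realType) (b c x : R) (m : nat) :
  (H b c m.+3).[x] =
  - c * (H b c m.+2).[x] - b * (H b c m.+1).[x] - x * (H b c m).[x].
Proof. by rewrite H_rec !hornerE; ring. Qed.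

(** Only the term ['X * H b c m] raises the degree, and it advances the index by three. *)
Lemma size_H (R : realType) (b c : R) (m : nat) :
  (size (H b c m) <= (m %/ 3).+1)%N.
Proof.
elim/nat_ind3: m => [|||m IH0 IH1 IH2].
- by rewrite /= size_poly1.
- exact: size_polyC_leq1.
- exact: size_polyC_leq1.
have E : (m.+3 %/ 3 = (m %/ 3).+1)%N by lia.
rewrite H_rec E.
have le1 : (m.+1 %/ 3 <= (m %/ 3).+1)%N by lia.
have le2 : (m.+2 %/ 3 <= (m %/ 3).+1)%N by lia.
rewrite (leq_trans (size_polyD _ _)) // geq_max size_polyN; apply/andP; split.
  rewrite (leq_trans (size_polyD _ _)) // geq_max !size_polyN; apply/andP; split.
    by rewrite (leq_trans (size_scale_leq _ _)) // (leq_trans IH2).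
  by rewrite (leq_trans (size_scale_leq _ _)) // (leq_trans IH1).
by rewrite (leq_trans (size_polyMleq _ _)) // size_polyX.
Qed.

(** Weighted homogeneity: c, b, z have weights 1, 2, 3 and H_m has weight m. This reduces c <> 0 to
    c = 1. *)
Lemma H_scale (R : realType) (b c x : R) (m : nat) : c != 0 ->
  (H b c m).[c ^+ 3 * x] = c ^+ m * (H (b / c ^+ 2) 1 m).[x].
Proof.
move=> c0; elim/nat_ind3: m => [|||m IH0 IH1 IH2].
- by rewrite /= !hornerE; ring.
- by rewrite /= !hornerE; ring.
- by rewrite /= !hornerE expr1n; field.
by rewrite !horner_H_rec IH0 IH1 IH2 !exprS; field.
Qed.

Lemma coef_H_top (R : realType) (b c : R) (n : nat) :
  [/\ (H b c (3 * n))`_n = (-1) ^+ n,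
      (H b c (3 * n).+1)`_n = - (-1) ^+ n * c * n.+1%:R &
      (H b c (3 * n).+2)`_n =
        (-1) ^+ n * n.+1%:R * (c ^+ 2 * (n.+2)%:R / 2 - b)].
Proof.
(* Coefficients beyond the degree bound vanish, which removes most terms of the coefficient
   recurrence in the induction below. *)
have H0 k m : (m %/ 3 < k)%N -> (H b c m)`_k = 0.
  move=> mk; apply/(leq_sizeP _ k); last exact: leqnn.
  by rewrite (leq_trans (size_H _ _ _ _)).
have coefS m k : (H b c m.+3)`_k.+1 =
    - c * (H b c m.+2)`_k.+1 - b * (H b c m.+1)`_k.+1 - (H b c m)`_k.
  by rewrite H_rec !coefB coefN !coefZ coefXM /=; ring.
elim: n => [|n [IH0 IH1 IH2]].
  split=> /=; rewrite ?coefC /= ?expr0 ?mulr1 ?mul1r//; first by ring.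
  by field.
have -> : (3 * n.+1 = (3 * n).+3)%N by lia.
have A : (H b c (3 * n).+3)`_n.+1 = (-1) ^+ n.+1.
  by rewrite coefS IH0 !H0; [rewrite exprS; ring | lia | lia].
have B : (H b c (3 * n).+4)`_n.+1 = - (-1) ^+ n.+1 * c * n.+2%:R.
  rewrite coefS A IH1 H0; last by lia.
  by rewrite exprS !mulrSr; ring.
split=> //.
by rewrite coefS B A IH2 exprS -(natr1 n.+2) -(natr1 n.+1) -(natr1 n); field.
Qed.

(** The hypotheses are Vieta's relations for the roots t e^(i th), t e^(-i th), s at z = -t^2 s. The
    identity is the sum of s_j^(m+2) / F'(s_j), cleared of the denominator sin th |s - t e^(i
    th)|^2; both sides satisfy the same recurrence. *)
Lemma H_polar (R : realType) (b c t s th : R) (m : nat) :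
  c = - (2 * t * cos th + s) -> b = t ^+ 2 + 2 * t * s * cos th ->
  (H b c m).[- (t ^+ 2 * s)] * (sin th * (t ^+ 2 - 2 * s * t * cos th + s ^+ 2)) =
  t ^+ m.+2 * sin (m.+1%:R * th) - s * t ^+ m.+1 * sin (m.+2%:R * th)
  + s ^+ m.+2 * sin th.
Proof.
move=> Ec Eb.
have sinS k : sin (k.+2%:R * th) = 2 * cos th * sin (k.+1%:R * th) - sin (k%:R * th).
  have -> : k.+2%:R * th = k.+1%:R * th + th by rewrite -[k.+2%:R]natr1; ring.
  have -> : k%:R * th = k.+1%:R * th - th by rewrite -[k.+1%:R]natr1; ring.
  by rewrite sinD sinB; ring.
elim/nat_ind3: m => [|||m IH0 IH1 IH2].
- by rewrite hornerC sinS !mul1r mul0r sin0; ring.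
- by rewrite hornerC !sinS !mul1r mul0r sin0 Ec; ring.
- by rewrite hornerC !sinS !mul1r mul0r sin0 Ec Eb; ring.
rewrite horner_H_rec; move: IH0 IH1 IH2; set W := sin th * _ => IH0 IH1 IH2.
have distr (u0 u1 u2 z : R) : (- c * u2 - b * u1 - z * u0) * W =
    - c * (u2 * W) - b * (u1 * W) - z * (u0 * W) by ring.
by rewrite distr IH0 IH1 IH2 !sinS Ec Eb !exprS; ring.
Qed.

(** * Necessity: two equimodular dominant roots at a nonreal point *)

Lemma rec3_ext (K : numFieldType) (c b z : K) (u v : nat -> K) :
  (forall m, u m.+3 + c * u m.+2 + b * u m.+1 + z * u m =
             v m.+3 + c * v m.+2 + b * v m.+1 + z * v m) ->
  u 0 = v 0 -> u 1%N = v 1%N -> u 2%N = v 2%N -> forall m, u m = v m.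
Proof.
move=> rec u0 u1 u2; elim/nat_ind3 => // m E0 E1 E2.
by have := rec m; rewrite E0 E1 E2 => /addIr /addIr /addIr.
Qed.

(** With E the shift, (E - s)(E - t) kills the modes s^m and t^m and multiplies r^m by (r - s)(r -
    t); evaluating at 0 gives the coefficient [e r s t]. *)
Lemma rec3_simple_roots (K : numFieldType) (s1 s2 s3 : K) (u : nat -> K) :
  s1 != s2 -> s1 != s3 -> s2 != s3 ->
  (forall m, u m.+3 - (s1 + s2 + s3) * u m.+2
     + (s1 * s2 + s1 * s3 + s2 * s3) * u m.+1 - s1 * s2 * s3 * u m = 0) ->
  let e r s t := (u 2%N - (s + t) * u 1%N + s * t * u 0) / ((r - s) * (r - t)) in
  forall m, u m = e s1 s2 s3 * s1 ^+ m + e s2 s1 s3 * s2 ^+ m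
                  + e s3 s1 s2 * s3 ^+ m.
Proof.
rewrite -(subr_eq0 s1 s2) -(subr_eq0 s1 s3) -(subr_eq0 s2 s3) => n12 n13 n23 rec e.
have n21 : s2 - s1 != 0 by rewrite -oppr_eq0 opprB.
have n31 : s3 - s1 != 0 by rewrite -oppr_eq0 opprB.
have n32 : s3 - s2 != 0 by rewrite -oppr_eq0 opprB.
apply: (@rec3_ext K (- (s1 + s2 + s3)) (s1 * s2 + s1 * s3 + s2 * s3)
  (- (s1 * s2 * s3))).
- by move=> m; rewrite !mulNr rec !exprS; ring.
- by rewrite /e; field; rewrite n12 n13 n23 n21 n31 n32.
- by rewrite /e; field; rewrite n12 n13 n23 n21 n31 n32.
- by rewrite /e; field; rewrite n12 n13 n23 n21 n31 n32.
Qed.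

(* T = s F'(s) for the characteristic polynomial F with roots s1, s2, s3; a
   forcing term of degree d resonates to a solution of degree d + 1. *)
Lemma rec3_resonance (K : numFieldType) (s1 s2 s3 p1 p2 p3 q1 q2 q3 : K)
    (u : nat -> K) :
  s1 != s2 -> s1 != s3 -> s2 != s3 -> s1 != 0 -> s2 != 0 -> s3 != 0 ->
  (forall m, u m.+3 - (s1 + s2 + s3) * u m.+2
     + (s1 * s2 + s1 * s3 + s2 * s3) * u m.+1 - s1 * s2 * s3 * u m =
     (p1 * m%:R + q1) * s1 ^+ m + (p2 * m%:R + q2) * s2 ^+ m
     + (p3 * m%:R + q3) * s3 ^+ m) ->
  let T r s t := r * ((r - s) * (r - t)) in
  let T1 := T s1 s2 s3 in let T2 := T s2 s1 s3 in let T3 := T s3 s1 s2 in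
  let E r := 9 * r ^+ 3 - 4 * (s1 + s2 + s3) * r ^+ 2
             + (s1 * s2 + s1 * s3 + s2 * s3) * r in
  let d r p q t := (q - p / (2 * t) * E r) / t in
  exists e1 e2 e3, forall m,
    u m = (p1 / (2 * T1) * m%:R ^+ 2 + d s1 p1 q1 T1 * m%:R + e1) * s1 ^+ m
        + (p2 / (2 * T2) * m%:R ^+ 2 + d s2 p2 q2 T2 * m%:R + e2) * s2 ^+ m
        + (p3 / (2 * T3) * m%:R ^+ 2 + d s3 p3 q3 T3 * m%:R + e3) * s3 ^+ m.
Proof.
move=> n12 n13 n23 s10 s20 s30 rec T T1 T2 T3 E d.
have T10 : T1 != 0 by rewrite !mulf_neq0 // subr_eq0.
have T20 : T2 != 0 by rewrite !mulf_neq0 // subr_eq0 // eq_sym.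
have T30 : T3 != 0 by rewrite !mulf_neq0 // subr_eq0 // eq_sym.
pose f r g d m : K := (g * m%:R ^+ 2 + d * m%:R) * r ^+ m.
(* With D = r d/dr, one has t = D F and [E r] = D^2 F at the root r. The recurrence maps (g m^2 + h
   m) r^m to (2 g t m + h t + g E) r^m, and matching with p m + q yields g and h. *)
have fE r p q t m : t != 0 -> t = 3 * r ^+ 3 - 2 * (s1 + s2 + s3) * r ^+ 2
    + (s1 * s2 + s1 * s3 + s2 * s3) * r ->
    (r - s1) * (r - s2) * (r - s3) = 0 ->
    let g := p / (2 * t) in let h := d r p q t in
    f r g h m.+3 - (s1 + s2 + s3) * f r g h m.+2
     + (s1 * s2 + s1 * s3 + s2 * s3) * f r g h m.+1 - s1 * s2 * s3 * f r g h m
    = (p * m%:R + q) * r ^+ m.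
  move=> t0 tE root g h.
  have pE : p = 2 * g * t by rewrite /g; field.
  have qE : q = h * t + g * E r by rewrite /h /d /g; field.
  rewrite pE qE tE /E /f -(natr1 m.+2) -(natr1 m.+1) -(natr1 m) !exprS.
  have -> : forall x y : K, (x = y) <-> (x - y = 0).
    by move=> x y; split=> [->|/eqP]; [rewrite subrr | rewrite subr_eq0 => /eqP].
  transitivity ((r - s1) * (r - s2) * (r - s3) * (g * m%:R ^+ 2 + h * m%:R) * r ^+ m).
    by ring.
  by rewrite root !mul0r.
have T1E : T1 = 3 * s1 ^+ 3 - 2 * (s1 + s2 + s3) * s1 ^+ 2
    + (s1 * s2 + s1 * s3 + s2 * s3) * s1 by rewrite /T1 /T; ring.
have T2E : T2 = 3 * s2 ^+ 3 - 2 * (s1 + s2 + s3) * s2 ^+ 2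
    + (s1 * s2 + s1 * s3 + s2 * s3) * s2 by rewrite /T2 /T; ring.
have T3E : T3 = 3 * s3 ^+ 3 - 2 * (s1 + s2 + s3) * s3 ^+ 2
    + (s1 * s2 + s1 * s3 + s2 * s3) * s3 by rewrite /T3 /T; ring.
have r1 : (s1 - s1) * (s1 - s2) * (s1 - s3) = 0 by ring.
have r2 : (s2 - s1) * (s2 - s2) * (s2 - s3) = 0 by ring.
have r3 : (s3 - s1) * (s3 - s2) * (s3 - s3) = 0 by ring.
pose f1 := f s1 (p1 / (2 * T1)) (d s1 p1 q1 T1).
pose f2 := f s2 (p2 / (2 * T2)) (d s2 p2 q2 T2).
pose f3 := f s3 (p3 / (2 * T3)) (d s3 p3 q3 T3).
have F1 m : f1 m.+3 - (s1 + s2 + s3) * f1 m.+2 + (s1 * s2 + s1 * s3 + s2 * s3)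
    * f1 m.+1 - s1 * s2 * s3 * f1 m = (p1 * m%:R + q1) * s1 ^+ m.
  exact: fE.
have F2 m : f2 m.+3 - (s1 + s2 + s3) * f2 m.+2 + (s1 * s2 + s1 * s3 + s2 * s3)
    * f2 m.+1 - s1 * s2 * s3 * f2 m = (p2 * m%:R + q2) * s2 ^+ m.
  exact: fE.
have F3 m : f3 m.+3 - (s1 + s2 + s3) * f3 m.+2 + (s1 * s2 + s1 * s3 + s2 * s3)
    * f3 m.+1 - s1 * s2 * s3 * f3 m = (p3 * m%:R + q3) * s3 ^+ m.
  exact: fE.

(* Removing the particular solutions leaves a homogeneous one, which supplies [e1], [e2], [e3]. *)
pose v m := u m - (f1 m + f2 m + f3 m).
have recv m : v m.+3 - (s1 + s2 + s3) * v m.+2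
     + (s1 * s2 + s1 * s3 + s2 * s3) * v m.+1 - s1 * s2 * s3 * v m = 0.
  transitivity ((u m.+3 - (s1 + s2 + s3) * u m.+2
     + (s1 * s2 + s1 * s3 + s2 * s3) * u m.+1 - s1 * s2 * s3 * u m)
     - (f1 m.+3 - (s1 + s2 + s3) * f1 m.+2
     + (s1 * s2 + s1 * s3 + s2 * s3) * f1 m.+1 - s1 * s2 * s3 * f1 m)
     - (f2 m.+3 - (s1 + s2 + s3) * f2 m.+2
     + (s1 * s2 + s1 * s3 + s2 * s3) * f2 m.+1 - s1 * s2 * s3 * f2 m)
     - (f3 m.+3 - (s1 + s2 + s3) * f3 m.+2
     + (s1 * s2 + s1 * s3 + s2 * s3) * f3 m.+1 - s1 * s2 * s3 * f3 m)).
    rewrite /v.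
    move: (u m) (u m.+1) (u m.+2) (u m.+3) (f1 m) (f1 m.+1) (f1 m.+2) (f1 m.+3)
      (f2 m) (f2 m.+1) (f2 m.+2) (f2 m.+3) (f3 m) (f3 m.+1) (f3 m.+2) (f3 m.+3).
    clear. move=> *. ring.
  by rewrite rec F1 F2 F3; ring.

have [e1 [e2 [e3 sol]]] : exists e1 e2 e3, forall m,
    v m = e1 * s1 ^+ m + e2 * s2 ^+ m + e3 * s3 ^+ m.
  do 3!eexists; exact: (@rec3_simple_roots K s1 s2 s3 v n12 n13 n23 recv).
exists e1, e2, e3 => m.
have -> : u m = v m + (f1 m + f2 m + f3 m) by rewrite /v subrK.
rewrite sol /f1 /f2 /f3 /f; move: (p1 / _) (p2 / _) (p3 / _) (d _ _ _ _).
by move=> g1 g2 g3 h1; move: (d _ _ _ _) (d _ _ _ _) => h2 h3; ring.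
Qed.

Set Implicit Arguments.
Unset Strict Implicit.
Unset Printing Implicit Defensive.
Local Open Scope complex_scope.

(** * The real-valued modulus on [R[i]] and a Laguerre-type inequality *)

Definition modc (R : rcfType) (x : R[i]) : R := ComplexField.Normc.normc x.

Lemma modcM (R : rcfType) (x y : R[i]) : modc (x * y) = modc x * modc y.
Proof. exact: ComplexField.Normc.normcM. Qed.

Lemma modc0 (R : rcfType) : modc (0 : R[i]) = 0.
Proof. exact: ComplexField.Normc.normc0. Qed.

Lemma modcD (R : rcfType) (x y : R[i]) : modc (x + y) <= modc x + modc y.
Proof. exact: le_normcD. Qed.

Lemma modcN (R : rcfType) (x : R[i]) : modc (- x) = modc x.
Proof. exact: normcN. Qed.

Lemma modcX (R : rcfType) (x : R[i]) (n : nat) : modc (x ^+ n) = modc x ^+ n.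
Proof.
elim: n => [|n IH]; first by rewrite !expr0 /modc ComplexField.Normc.normc1.
by rewrite !exprS modcM IH.
Qed.

Lemma modc_nat (R : rcfType) (n : nat) : modc (n%:R : R[i]) = n%:R.
Proof.
have -> : (n%:R : R[i]) = (n%:R)%:C by rewrite rmorph_nat.
by rewrite /modc /= expr0n /= addr0 sqrtr_sqr ger0_norm.
Qed.

Lemma modc_sqr (R : rcfType) (x : R[i]) : modc x ^+ 2 = complex.Re x ^+ 2 + complex.Im x ^+ 2.
Proof. by case: x => a d; rewrite /modc /= sqr_sqrtr // addr_ge0 ?sqr_ge0. Qed.

Lemma modc_ge0 (R : rcfType) (x : R[i]) : 0 <= modc x.
Proof. by case: x => a d; rewrite /modc /= sqrtr_ge0. Qed.

Lemma modc_gt0 (R : rcfType) (x : R[i]) : (0 < modc x) = (x != 0).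
Proof.
rewrite lt_neqAle modc_ge0 andbT eq_sym; congr (~~ _).
by apply/eqP/eqP => [|->]; [exact: ComplexField.Normc.eq0_normc | exact: modc0].
Qed.

Lemma Im_le_modc (R : rcfType) (x : R[i]) : complex.Im x ^+ 2 <= modc x ^+ 2.
Proof. by rewrite modc_sqr lerDr sqr_ge0. Qed.

(* For p = k * prod (x - r_j), the left-hand side without the modulus is
   - p ^ 2 * sum 1 / (z - r_j) ^ 2. *)
Lemma real_rooted_laguerre (R : rcfType) (rs : seq R[i]) (k z : R[i]) :
  all (fun r => complex.Im r == 0) rs -> complex.Im z != 0 ->
  let p := k *: \prod_(r <- rs) ('X - r%:P) in
  modc (p^`()^`().[z] * p.[z] - p^`().[z] ^+ 2)
    <= (size rs)%:R / complex.Im z ^+ 2 * modc p.[z] ^+ 2.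
Proof.
move=> rsR zI; have y0 : 0 < complex.Im z ^+ 2 by rewrite exprn_even_gt0.
elim: rs rsR => [_|r rs IH /= /andP[/eqP rR /IH {}IH]] /=.
  by rewrite big_nil -mul_polyC mulr1 !derivC horner0 mul0r expr0n subrr modc0 !mul0r.
have -> : k *: \prod_(j <- r :: rs) ('X - j%:P) =
    (k *: \prod_(j <- rs) ('X - j%:P)) * ('X - r%:P).
  by rewrite big_cons mulrC scalerAl.
move: IH => /=; set q := k *: _ => IH; set p := q * _.
have -> : p.[z] = q.[z] * (z - r) by rewrite /p !hornerE.
have -> : p^`().[z] = q^`().[z] * (z - r) + q.[z].
  by rewrite /p derivM derivXsubC mulr1 !hornerE.
have -> : p^`()^`().[z] = q^`()^`().[z] * (z - r) + 2 * q^`().[z].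
  by rewrite /p derivM derivXsubC mulr1 derivD derivM derivXsubC mulr1 !hornerE; ring.
have -> : (q^`()^`().[z] * (z - r) + 2 * q^`().[z]) * (q.[z] * (z - r)) -
    (q^`().[z] * (z - r) + q.[z]) ^+ 2 =
  (q^`()^`().[z] * q.[z] - q^`().[z] ^+ 2) * (z - r) ^+ 2 + - q.[z] ^+ 2 by ring.
apply: (le_trans (modcD _ _)); rewrite modcN modcM !modcX modcM.
(* As r is real, z - r and z have the same imaginary part. *)
have zr : complex.Im z ^+ 2 <= modc (z - r) ^+ 2.
  by have := Im_le_modc (z - r); rewrite raddfB /= rR subr0.
rewrite -(natr1 (size rs)) !mulrDl exprMn; apply: lerD.
  by rewrite [leRHS]mulrA; apply: ler_wpM2r; rewrite ?sqr_ge0.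
have -> : 1 / complex.Im z ^+ 2 * (modc q.[z] ^+ 2 * modc (z - r) ^+ 2) =
    modc q.[z] ^+ 2 * (modc (z - r) ^+ 2 / complex.Im z ^+ 2) by ring.
by rewrite ler_peMr ?sqr_ge0 // ler_pdivlMr // mul1r.
Qed.

(** * Growth estimates and the contradiction from two dominant roots *)

Lemma bernoulli_decay (R : realFieldType) (r : R) (m : nat) : 0 <= r -> r < 1 ->
  m%:R * r ^+ m * (1 - r) <= 1.
Proof.
(* This compares m r^m with the geometric sum 1 + r + ... + r^(m-1), each term of which is at least
   r^m. *)
move=> r0 r1; suff : m%:R * r ^+ m * (1 - r) <= 1 - r ^+ m.
  by move=> /le_trans; apply; rewrite lerBlDr lerDl exprn_ge0.
elim: m => [|m IH]; first by rewrite mul0r mul0r expr0 subrr.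
have h : r ^+ m <= 1 by rewrite exprn_ile1 // ltW.
have h0 : 0 <= r ^+ m by rewrite exprn_ge0.
have rh : r * r ^+ m <= 1 by rewrite mulr_ile1 // ltW.
have := ler_wpM2l r0 IH.
have : 0 <= (1 - r) * (1 - r * r ^+ m) by rewrite mulr_ge0 // subr_ge0 // ltW.
by rewrite -(natr1 m) exprS; lra.
Qed.

Definition geom_bounded (R : rcfType) (M : R) (f : nat -> R[i]) :=
  exists2 k : R, 0 <= k & forall m, modc (f m) <= k * M ^+ m.

Lemma geom_boundedD (R : rcfType) (M : R) (f g : nat -> R[i]) :
  geom_bounded M f -> geom_bounded M g ->
  geom_bounded M (fun m => f m + g m).
Proof.
move=> [k k0 kf] [l l0 lg]; exists (k + l) => [|m]; first exact: addr_ge0.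
by rewrite mulrDl (le_trans (modcD _ _)) // lerD.
Qed.

Lemma geom_boundedN (R : rcfType) (M : R) (f : nat -> R[i]) : geom_bounded M f ->
  geom_bounded M (fun m => - f m).
Proof. by move=> [k k0 kf]; exists k => // m; rewrite modcN. Qed.

Lemma geom_boundedM (R : rcfType) (M N : R) (f g : nat -> R[i]) :
  geom_bounded M f -> geom_bounded N g ->
  geom_bounded (M * N) (fun m => f m * g m).
Proof.
move=> [k k0 kf] [l l0 lg]; exists (k * l) => [|m]; first exact: mulr_ge0.
by rewrite modcM exprMn mulrACA ler_pM ?modc_ge0.
Qed.

Lemma geom_boundedX (R : rcfType) (M : R) (a s : R[i]) : modc s <= M ->
  geom_bounded M (fun m => a * s ^+ m).
Proof.
move=> sM; exists (modc a) => [|m]; first exact: modc_ge0.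
by rewrite modcM modcX ler_wpM2l ?modc_ge0 // lerXn2r ?nnegrE ?modc_ge0 // (le_trans (modc_ge0 s)).
Qed.

Lemma real_natmul_bounded_eq0 (R : realType) (k l n : R) :
  0 <= k -> (forall m : nat, k * m%:R ^+ 2 <= l * m%:R + n) -> k = 0.
Proof.
move=> k0 H; apply/eqP; rewrite eq_le k0 andbT leNgt; apply/negP => kp.
have [m Hm] : exists m : nat, (`|l| + `|n| + 1) / k < m%:R.
  exists (Num.bound ((`|l| + `|n| + 1) / k)).
  by apply: archi_boundP; rewrite divr_ge0 ?(ltW kp) // !addr_ge0.
have {H} := H m; move: Hm; rewrite ltr_pdivrMr // => Hm.
have m1 : 1 <= (m%:R : R).
  rewrite ler1n lt0n; apply/eqP => m0; move: Hm; rewrite m0 mul0r.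
  by apply/negP; rewrite -leNgt !addr_ge0.
have := ler_norm l; have := ler_norm n; have := normr_ge0 l; have := normr_ge0 n.
move: Hm m1; move: (m%:R) `|l| `|n| => x L N; nra.
Qed.

(** The sequences u, v, w stand for H_m, H_m', H_m'' at a fixed z: differentiating the recurrence in
    z produces the forcing terms -u and -2 v. The last hypothesis is the bound that real-rootedness
    imposes. *)
Lemma two_dominant_roots_contra (R : realType) (s1 s2 s3 : R[i]) (K : R)
    (u v w : nat -> R[i]) :
  let rec f m := f m.+3 - (s1 + s2 + s3) * f m.+2
    + (s1 * s2 + s1 * s3 + s2 * s3) * f m.+1 - s1 * s2 * s3 * f m in
  s1 != s2 -> s1 != 0 -> s3 != 0 ->
  modc s1 = modc s2 -> modc s3 < modc s1 ->
  s1 * (s1 - s3) + s2 * (s2 - s3) != 0 ->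
  u 0%N = 1 -> u 1%N = s1 + s2 + s3 ->
  u 2%N = (s1 + s2 + s3) ^+ 2 - (s1 * s2 + s1 * s3 + s2 * s3) ->
  (forall m, rec u m = 0) ->
  (forall m, rec v m = - u m) ->
  (forall m, rec w m = - 2 * v m) ->
  0 <= K ->
  (forall m, modc (w m * u m - v m ^+ 2) <= m%:R * K * modc (u m) ^+ 2) ->
  False.
Proof.
move=> rec n12 s10 s30 e12 l31 ngen u0 u1 u2 recu recv recw K0 lag.
have n13 : s1 != s3 by apply: contraTneq l31 => ->; rewrite ltxx.
have n23 : s2 != s3 by apply: contraTneq l31; rewrite e12 => ->; rewrite ltxx.
have s20 : s2 != 0 by rewrite -modc_gt0 -e12 modc_gt0.
have d12 : s1 - s2 != 0 by rewrite subr_eq0.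
have d13 : s1 - s3 != 0 by rewrite subr_eq0.
have d23 : s2 - s3 != 0 by rewrite subr_eq0.
have d21 : s2 - s1 != 0 by rewrite subr_eq0 eq_sym.
have d31 : s3 - s1 != 0 by rewrite subr_eq0 eq_sym.
have d32 : s3 - s2 != 0 by rewrite subr_eq0 eq_sym.
pose A1 := s1 ^+ 2 / ((s1 - s2) * (s1 - s3)).
pose A2 := s2 ^+ 2 / ((s2 - s1) * (s2 - s3)).
pose A3 := s3 ^+ 2 / ((s3 - s1) * (s3 - s2)).
(* Here T_j = s_j F'(s_j), so -1 / T_j is the logarithmic derivative of s_j in z. To leading order
   the modes of u, v, w are A_j, -m A_j / T_j and m^2 A_j / T_j^2 times s_j^m. *)
pose T1 := s1 * ((s1 - s2) * (s1 - s3)).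
pose T2 := s2 * ((s2 - s1) * (s2 - s3)).
pose T3 := s3 * ((s3 - s1) * (s3 - s2)).
have uE m : u m = A1 * s1 ^+ m + A2 * s2 ^+ m + A3 * s3 ^+ m.
  have := @rec3_simple_roots _ s1 s2 s3 u n12 n13 n23 recu.
  rewrite /= u0 u1 u2 => ->; rewrite /A1 /A2 /A3.
  by congr (_ / _ * _ + _ / _ * _ + _ / _ * _); ring.
have [|b1 [b2 [b3 vE]]] := @rec3_resonance _ s1 s2 s3 0 0 0 (- A1) (- A2) (- A3)
    v n12 n13 n23 s10 s20 s30.
  by move=> m; rewrite -/(rec v m) recv uE; ring.
rewrite -/T1 -/T2 -/T3 in vE.
pose a1 := - A1 / T1; pose a2 := - A2 / T2; pose a3 := - A3 / T3.
have {}vE m : v m = (a1 * m%:R + b1) * s1 ^+ m + (a2 * m%:R + b2) * s2 ^+ m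
    + (a3 * m%:R + b3) * s3 ^+ m.
  by rewrite vE !(mul0r, subr0) !add0r.
have [|e1 [e2 [e3 wE]]] := @rec3_resonance _ s1 s2 s3 (- 2 * a1) (- 2 * a2)
    (- 2 * a3) (- 2 * b1) (- 2 * b2) (- 2 * b3) w n12 n13 n23 s10 s20 s30.
  by move=> m; rewrite -/(rec w m) recw vE; ring.
move: wE; rewrite -/T1 -/T2 -/T3.
set g1 := _ / (2 * T1); set g2 := _ / (2 * T2); set g3 := _ / (2 * T3).
set h1 := (_ / T1); set h2 := (_ / T2); set h3 := (_ / T3) => wE.
pose M := modc s1.
pose qa m := a1 * s1 ^+ m + a2 * s2 ^+ m + a3 * s3 ^+ m.
pose qb m := b1 * s1 ^+ m + b2 * s2 ^+ m + b3 * s3 ^+ m.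
pose rg m := g1 * s1 ^+ m + g2 * s2 ^+ m + g3 * s3 ^+ m.
pose rh m := h1 * s1 ^+ m + h2 * s2 ^+ m + h3 * s3 ^+ m.
pose re m := e1 * s1 ^+ m + e2 * s2 ^+ m + e3 * s3 ^+ m.
have bnd x y z : geom_bounded M (fun m => x * s1 ^+ m + y * s2 ^+ m + z * s3 ^+ m).
  by apply: geom_boundedD; [apply: geom_boundedD|]; apply: geom_boundedX;
     rewrite // -?e12 // ltW.
(* In the m^2 part of w u - v^2 the squares s_j^(2m) cancel, and each pair i < j contributes A_i A_j
   (1/T_i - 1/T_j)^2 (s_i s_j)^m. Only the pair 1, 2 reaches size M^(2m). *)
pose k12 := A1 * A2 * (T1^-1 - T2^-1) ^+ 2.
pose k13 := A1 * A3 * (T1^-1 - T3^-1) ^+ 2.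
pose k23 := A2 * A3 * (T2^-1 - T3^-1) ^+ 2.
pose X m := k13 * s1 ^+ m + k23 * s2 ^+ m.
pose Y m := rh m * u m + - (qa m * (2 * qb m)).
pose Z m := re m * u m + - (qb m * qb m).
have T10 : T1 != 0 by rewrite !mulf_neq0.
have T20 : T2 != 0 by rewrite !mulf_neq0.
have T30 : T3 != 0 by rewrite !mulf_neq0.
have key m : w m * u m - v m ^+ 2 = m%:R ^+ 2 * (k12 * (s1 * s2) ^+ m)
    + m%:R ^+ 2 * (X m * s3 ^+ m) + m%:R * Y m + Z m.
  have -> : w m = rg m * m%:R ^+ 2 + rh m * m%:R + re m.
    by rewrite wE /rg /rh /re; ring.
  have -> : v m = qa m * m%:R + qb m by rewrite vE /qa /qb; ring.
  have -> : (rg m * m%:R ^+ 2 + rh m * m%:R + re m) * u m - (qa m * m%:R + qb m) ^+ 2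
     = m%:R ^+ 2 * (rg m * u m - qa m ^+ 2) + m%:R * Y m + Z m.
    by rewrite /Y /Z; ring.
  congr (_ + _ + _); rewrite -mulrDr; congr (_ * _).
  have g1E : g1 = A1 / T1 ^+ 2 by rewrite /g1 /a1; field.
  have g2E : g2 = A2 / T2 ^+ 2 by rewrite /g2 /a2; field.
  have g3E : g3 = A3 / T3 ^+ 2 by rewrite /g3 /a3; field.
  rewrite uE /rg /qa /X g1E g2E g3E /a1 /a2 /a3 /k12 /k13 /k23 [(s1 * s2) ^+ m]exprMn -!exprVn.
  have alg (t1 t2 t3 y1 y2 y3 x1 x2 x3 : R[i]) :
    (y1 * t1 ^+ 2 * x1 + y2 * t2 ^+ 2 * x2 + y3 * t3 ^+ 2 * x3)
      * (y1 * x1 + y2 * x2 + y3 * x3)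
    - (- y1 * t1 * x1 - y2 * t2 * x2 - y3 * t3 * x3) ^+ 2 =
    y1 * y2 * (t1 - t2) ^+ 2 * (x1 * x2)
    + (y1 * y3 * (t1 - t3) ^+ 2 * x1 + y2 * y3 * (t2 - t3) ^+ 2 * x2) * x3 by ring.
  by rewrite -alg !mulNr.
have k120 : k12 != 0.
  have A10 : A1 != 0.
    by rewrite /A1 mulf_neq0 ?expf_neq0 // invr_eq0 mulf_neq0.
  have A20 : A2 != 0.
    by rewrite /A2 mulf_neq0 ?expf_neq0 // invr_eq0 mulf_neq0.
  apply: mulf_neq0; first exact: mulf_neq0.
  apply: expf_neq0.
  (* Up to the factor s1 - s2, the equality T1 = T2 is the degeneracy excluded by [ngen]. *)
  apply: contraNneq ngen => /eqP; rewrite subr_eq0 => /eqP/invr_inj E.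
  have /eqP := E; rewrite -subr_eq0.
  have -> : T1 - T2 = (s1 - s2) * (s1 * (s1 - s3) + s2 * (s2 - s3)).
    by rewrite /T1 /T2; ring.
  by rewrite mulf_eq0 (negPf d12).
have M0 : 0 < M by rewrite modc_gt0.
pose r := modc s3 / M.
have r0 : 0 <= r by rewrite divr_ge0 ?modc_ge0.
have r1 : r < 1 by rewrite ltr_pdivrMr // mul1r.
have [cX cX0 XB] : geom_bounded M X.
  by apply: geom_boundedD; apply: geom_boundedX; rewrite // -e12.
have ubd : geom_bounded M u.
  have [k k0 kB] := bnd A1 A2 A3; exists k => // m; rewrite uE; exact: kB.
have [cY cY0 YB] : geom_bounded (M * M) Y.
  apply: geom_boundedD; first by apply: geom_boundedM => //; exact: bnd.
  apply/geom_boundedN/geom_boundedM; first exact: bnd.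
  have [k k0 kB] := bnd b1 b2 b3; exists (2 * k) => [|m]; first by rewrite mulr_ge0.
  by rewrite modcM (modc_nat _ 2) -mulrA ler_wpM2l //; exact: kB.
have [cZ cZ0 ZB] : geom_bounded (M * M) Z.
  apply: geom_boundedD; first by apply: geom_boundedM => //; exact: bnd.
  by apply/geom_boundedN/geom_boundedM; exact: bnd.
have [cU cU0 UB] := ubd.
suff : modc k12 = 0 by move/eqP; rewrite eq_le leNgt modc_gt0 k120.
(* After division by M^(2m) everything but the k12 term is O(m); in the terms with s3, one factor m
   is absorbed by r^m at the cost of 1 / (1 - r). *)
apply: (@real_natmul_bounded_eq0 R _ (cX / (1 - r) + cY + K * cU ^+ 2) cZ).
  exact: modc_ge0.
move=> m.
have Mm0 : 0 < (M * M) ^+ m by rewrite exprn_gt0 // mulr_gt0.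
rewrite -(ler_pM2r Mm0).
have B1 : modc (k12 * (s1 * s2) ^+ m) = modc k12 * (M * M) ^+ m.
  by rewrite modcM modcX [modc (s1 * s2)]modcM -e12.
have tri : m%:R ^+ 2 * modc (k12 * (s1 * s2) ^+ m) <=
    modc (w m * u m - v m ^+ 2) + m%:R ^+ 2 * modc (X m * s3 ^+ m)
    + m%:R * modc (Y m) + modc (Z m).
  rewrite -(modc_nat R m) -modcX -!modcM.
  have -> : m%:R ^+ 2 * (k12 * (s1 * s2) ^+ m) = (w m * u m - v m ^+ 2)
     + - (m%:R ^+ 2 * (X m * s3 ^+ m)) + - (m%:R * Y m) + - Z m.
    by rewrite key; ring.
  do 3!(apply: (le_trans (modcD _ _)); rewrite modcN lerD2r).
  by [].
have m0 : 0 <= (m%:R : R) by rewrite ler0n.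
have B2 : m%:R ^+ 2 * modc (X m * s3 ^+ m) <= m%:R * (cX / (1 - r)) * (M * M) ^+ m.
  have -> : modc (X m * s3 ^+ m) = modc (X m) * (r ^+ m * M ^+ m).
    by rewrite modcM modcX -exprMn /r divfK ?gt_eqF.
  have h : m%:R * r ^+ m <= (1 - r)^-1.
    by rewrite -[leRHS]mul1r ler_pdivlMr ?subr_gt0 //; exact: bernoulli_decay.
  have -> : m%:R ^+ 2 * (modc (X m) * (r ^+ m * M ^+ m)) =
     m%:R * ((m%:R * r ^+ m) * (modc (X m) * M ^+ m)) by ring.
  have -> : m%:R * (cX / (1 - r)) * (M * M) ^+ m =
     m%:R * ((1 - r)^-1 * (cX * M ^+ m * M ^+ m)) by rewrite exprMn; ring.
  rewrite ler_wpM2l // ler_pM ?mulr_ge0 ?exprn_ge0 ?modc_ge0 // ?(ltW M0) //.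
  by rewrite ler_wpM2r ?exprn_ge0 ?(ltW M0).
have B3 : m%:R * modc (Y m) <= m%:R * cY * (M * M) ^+ m.
  by rewrite -mulrA ler_wpM2l.
have B4 : modc (w m * u m - v m ^+ 2) <= m%:R * (K * cU ^+ 2) * (M * M) ^+ m.
  apply: (le_trans (lag m)).
  have -> : m%:R * (K * cU ^+ 2) * (M * M) ^+ m = m%:R * K * (cU * M ^+ m) ^+ 2.
    by rewrite !exprMn; ring.
  rewrite ler_wpM2l ?mulr_ge0 // lerXn2r ?nnegrE ?modc_ge0 //.
  by rewrite mulr_ge0 ?exprn_ge0 ?(ltW M0).
move: tri; rewrite B1 => tri; have := ZB m => B5.
have -> : modc k12 * m%:R ^+ 2 * (M * M) ^+ m = m%:R ^+ 2 * (modc k12 * (M * M) ^+ m).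
  by ring.
apply: (le_trans tri); apply: (le_trans (lerD (lerD (lerD B4 B2) B3) B5)).
by rewrite le_eqVlt; apply/orP; left; apply/eqP; ring.
Qed.

Lemma modc_conj (R : rcfType) (x : R[i]) : modc (x^*) = modc x.
Proof. by case: x => a d; rewrite /modc /= sqrrN. Qed.

Lemma laguerre_zeros_real (R : realType) (p : {poly R}) (z : R[i]) :
  zeros_real p -> complex.Im z != 0 ->
  let q := map_poly (real_complex R) p in
  modc (q^`()^`().[z] * q.[z] - q^`().[z] ^+ 2)
    <= (size p).-1%:R / complex.Im z ^+ 2 * modc q.[z] ^+ 2.
Proof.
move=> pR zI /=; set q := map_poly _ p; have [p0|p0] := eqVneq p 0.
  by rewrite /q p0 rmorph0 !deriv0 horner0 mul0r expr0n subrr modc0 mulr_ge0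
    ?mulr_ge0 ?invr_ge0 ?sqr_ge0.
have [rs qE] := closed_field_poly_normal q.
have q0 : q != 0 by rewrite map_poly_eq0.
rewrite /=; have -> : (size p).-1 = size rs.
  rewrite -(size_map_poly (real_complex R) p) -/q qE size_scale ?lead_coef_eq0 //.
  by rewrite size_prod_XsubC.
rewrite qE; apply: real_rooted_laguerre => //; apply/allP => r rin.
apply/eqP/(pR p0); rewrite -/q qE rootZ ?lead_coef_eq0 //.
by rewrite root_prod_XsubC.
Qed.

Lemma map_H_rec (R : realType) (b c : R) (m : nat) :
  let h k := map_poly (real_complex R) (H b c k) in
  h m.+3 = - (c%:C *: h m.+2) - (b%:C *: h m.+1) - 'X * h m.
Proof.
move=> h; rewrite /h H_rec.
move: (H b c m.+2) (H b c m.+1) (H b c m) => p2 p1 p0.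
by rewrite !rmorphB rmorphN rmorphM /= !map_polyZ map_polyX.
Qed.

(** The first two hypotheses make the s_j the roots of F at z = -s1 s2 s3. The values of H_m and its
    derivatives there contradict the Laguerre bound, with K = 1 / (Im z)^2. *)
Lemma equimodular_not_real (R : realType) (b c : R) (s1 s2 s3 : R[i]) :
  s1 + s2 + s3 = - c%:C -> s1 * s2 + s1 * s3 + s2 * s3 = b%:C ->
  s1 != s2 -> s3 != 0 -> modc s1 = modc s2 -> modc s3 < modc s1 ->
  s1 * (s1 - s3) + s2 * (s2 - s3) != 0 -> complex.Im s3 != 0 ->
  ~ (forall m : nat, zeros_real (H b c m)).
Proof.
move=> e1 e2 n12 s30 e12 l31 ngen im3 real.
have s10 : s1 != 0 by rewrite -modc_gt0 (le_lt_trans (modc_ge0 s3)).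
pose z := - (s1 * s2 * s3).
have zI : complex.Im z != 0.
  (* For real z the conjugate of s3 would be a root of F of modulus |s3| < |s1| = |s2|, hence s3
     itself, against Im s3 <> 0. *)
  apply/eqP => zR.
  have zc : z^* = z by case: (z) zR => x y /= ->; rewrite oppr0.
  have F x : (x - s1) * (x - s2) * (x - s3) =
      x ^+ 3 + c%:C * x ^+ 2 + b%:C * x + z.
    by rewrite -e2 -[c%:C]opprK -e1 /z; ring.
  have : (s3^* - s1) * (s3^* - s2) * (s3^* - s3) = 0.
    have := congr1 (@conjc R) (F s3).
    rewrite subrr mulr0 rmorph0 !rmorphD /=.
    rewrite (rmorphM (@conjc R) c%:C) (rmorphM (@conjc R) b%:C) !rmorphXn /=.
    by rewrite !oppr0 zc F => <-.
  move/eqP; rewrite !mulf_eq0 !subr_eq0 -orbA => /or3P[] /eqP E.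
  - by move: l31; rewrite -E modc_conj ltxx.
  - by move: l31; rewrite e12 -E modc_conj ltxx.
  - by move: im3; case: (s3) E => x y /= [] /eqP; rewrite eqNr => /eqP ->; rewrite eqxx.
pose h k := map_poly (real_complex R) (H b c k).
have hrec m : h m.+3 = - (c%:C *: h m.+2) - (b%:C *: h m.+1) - 'X * h m.
  exact: map_H_rec.
apply: (@two_dominant_roots_contra R s1 s2 s3 (complex.Im z ^+ 2)^-1
  (fun m => (h m).[z]) (fun m => (h m)^`().[z]) (fun m => (h m)^`()^`().[z])) => //.
- by rewrite /h /= rmorph1 hornerC.
- by rewrite /h /= map_polyC hornerC e1 /= rmorphN.
- by rewrite /h /= map_polyC hornerC e1 e2 /= rmorphD rmorphN rmorphXn /= sqrrN addrC.
- move=> m; rewrite hrec !hornerE e1 e2.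
  by move: (h m).[z] (h m.+1).[z] (h m.+2).[z] => *; rewrite /z; ring.
- move=> m; rewrite hrec !derivB !derivN !derivZ derivM derivX !hornerE e1 e2.
  move: (h m).[z] (h m)^`().[z] (h m.+1)^`().[z] (h m.+2)^`().[z] => *.
  by rewrite /z; ring.
- move=> m; rewrite hrec !(mul1r, derivB, derivN, derivZ, derivM, derivX, derivD).
  have -> : (1 : {poly R[i]})^`() = 0 by rewrite -polyC1 derivC.
  rewrite !(hornerD, hornerN, hornerZ, hornerM, hornerX, horner0) e1 e2.
  move: (h m)^`().[z] (h m)^`()^`().[z] (h m.+1)^`()^`().[z] (h m.+2)^`()^`().[z] => *.
  by rewrite /z; ring.
- by rewrite invr_ge0 sqr_ge0.
move=> m; apply: (le_trans (laguerre_zeros_real (real m) zI)).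
rewrite ler_wpM2r ?sqr_ge0 // ler_wpM2r ?invr_ge0 ?sqr_ge0 // ler_nat.
by have := size_H _ b c m; lia.
Qed.

(* With S = s1 + s2 = 1 / w, the quantity k = s1 s2 / S ^ 2 satisfies
   b w ^ 2 + c w + 1 - k = 0. Equality of the moduli of s1 != s2 means that k is
   real and > 1/4, the third hypothesis says that w is nonreal, and the fourth
   one that s3 is dominated. *)
Lemma not_real_of_kappa (R : realType) (b c k : R) :
  b != 0 -> 4^-1 < k -> c ^+ 2 < 4 * b * (1 - k) -> 1 - c ^+ 2 * k / b < k ->
  (c != 0) || (k != 1) -> ~ (forall m : nat, zeros_real (H b c m)).
Proof.
move=> b0 k4 disc dom ck.
pose d := Num.sqrt (4 * b * (1 - k) - c ^+ 2) / (2 * b).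
have dd : (2 * b * d) ^+ 2 = 4 * b * (1 - k) - c ^+ 2.
  by rewrite /d mulrC divfK ?sqr_sqrtr ?subr_ge0 ?(ltW disc) // mulf_neq0.
have d0 : d != 0.
  rewrite /d mulf_neq0 ?invr_eq0 ?mulf_neq0 // gt_eqF // sqrtr_gt0 subr_gt0 //.
pose n := Num.sqrt (4 * k - 1).
have nn : n ^+ 2 = 4 * k - 1 by rewrite sqr_sqrtr //; lra.
have n0 : n != 0 by rewrite gt_eqF // sqrtr_gt0; lra.
pose w : R[i] := (- c / (2 * b)) +i* d.
have w0 : w != 0 by rewrite eq_complex /= (negPf d0) andbF.
have wE : b%:C * w ^+ 2 + c%:C * w + (1 - k)%:C = 0.
  apply/eqP; rewrite eq_complex /=; apply/andP; split; apply/eqP; last by field.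
  have -> : d * d = (4 * b * (1 - k) - c ^+ 2) / (4 * b ^+ 2) by rewrite -dd; field.
  by field.
pose S := w^-1.
have S0 : S != 0 by rewrite invr_eq0.
(* [u1] and [u2] are the roots of X^2 - X + k, conjugate since k > 1/4. So [S * u1] and [S * u2]
   have equal moduli, sum S and product k S^2. *)
pose u1 : R[i] := (2^-1) +i* (n / 2).
pose u2 : R[i] := (2^-1) +i* (- n / 2).
have u12 : u1 + u2 = 1.
  by apply/eqP; rewrite eq_complex /=; apply/andP; split; apply/eqP; field.
have u1u2 : u1 * u2 = k%:C.
  apply/eqP; rewrite eq_complex /=; apply/andP; split; apply/eqP; last by field.
  have -> : k = (1 + n ^+ 2) / 4 by rewrite nn; field.
  by field.
have bE : b%:C = k%:C * S ^+ 2 - S ^+ 2 - c%:C * S.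
  have -> : b%:C = (b%:C * w ^+ 2 + c%:C * w + (1 - k)%:C) * S ^+ 2
     + k%:C * S ^+ 2 - S ^+ 2 - c%:C * S.
    by rewrite rmorphB rmorph1 /S; field.
  by rewrite wE mul0r add0r.
have modu : modc u1 ^+ 2 = k.
  by rewrite modc_sqr /= expr_div_n nn; field.
(* Since s3 = -S (c w + 1), domination amounts to |c w + 1|^2 < |u1|^2 = k. *)
have modw : modc (c%:C * w + 1) ^+ 2 = 1 - c ^+ 2 * k / b.
  rewrite modc_sqr /= !(mul0r, subr0, addr0) exprMn.
  have -> : d ^+ 2 = (4 * b * (1 - k) - c ^+ 2) / (4 * b ^+ 2) by rewrite -dd; field.
  by field.
have Imw : complex.Im (c%:C * w + 1) = c * d by rewrite /= mul0r !addr0.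
have s3E : - c%:C - S = - (S * (c%:C * w + 1)) by rewrite /S; field.
apply: (@equimodular_not_real R b c (S * u1) (S * u2) (- c%:C - S)).
- by rewrite -mulrDr u12; ring.
- have -> : S * u1 * (S * u2) + S * u1 * (- c%:C - S) + S * u2 * (- c%:C - S) =
    S ^+ 2 * (u1 * u2) + S * (u1 + u2) * (- c%:C - S) by ring.
  by rewrite u12 u1u2 bE; ring.
- rewrite (inj_eq (mulfI S0)) eq_complex /= negb_and; apply/orP; right.
  by apply: contra n0 => /eqP E; apply/eqP; lra.
- rewrite s3E oppr_eq0 mulf_neq0 //; have [c0|c0] := eqVneq c 0.
    by rewrite c0 rmorph0 mul0r add0r oner_neq0.
  by rewrite eq_complex Imw /= negb_and mulf_neq0 ?orbT.
- by rewrite !modcM; congr (_ * _); rewrite /modc /= mulNr sqrrN.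
- rewrite s3E modcN !modcM ltr_pM2l ?modc_gt0 //.
  by rewrite -(@ltr_pXn2r _ 2) ?nnegrE ?modc_ge0 // modu modw.
- have -> : S * u1 * (S * u1 - (- c%:C - S)) + S * u2 * (S * u2 - (- c%:C - S)) =
    S ^+ 2 * ((u1 + u2) ^+ 2 - 2 * (u1 * u2) + (u1 + u2) * (c%:C * w + 1)).
    by rewrite /S; field.
  rewrite u12 u1u2 mulf_neq0 ?expf_neq0 //.
  (* Vanishing would force c d = 0, so c = 0, and then k = 1, which [ck] rules out. *)
  have -> : 1 ^+ 2 - 2 * k%:C + 1 * (c%:C * w + 1) =
      (2 - 2 * k - c ^+ 2 / (2 * b)) +i* (c * d).
    apply/eqP; rewrite eq_complex /=; apply/andP; split; apply/eqP; last by ring.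
    by field.
  rewrite eq_complex /= negb_and.
  have [c0|c0] := eqVneq c 0; last by rewrite mulf_neq0 ?orbT.
  move: ck; rewrite c0 eqxx /= => k1; apply/orP; left.
  by apply: contra k1 => /eqP E; apply/eqP; move: E; rewrite expr0n mul0r; lra.
have -> : complex.Im (- c%:C - S) = - complex.Im S by rewrite raddfB raddfN /= oppr0 add0r.
rewrite oppr_eq0 /S /= oppr_eq0 mulf_neq0 // invr_eq0; move: w0.
by rewrite -modc_gt0 => /gt_eqF; rewrite -(@sqrf_eq0 _ (modc w)) modc_sqr => /negbT.
Qed.

Lemma real_zeros_necessary (R : realType) (b c : R) :
  (forall m : nat, zeros_real (H b c m)) ->
  (c = 0 /\ 0 <= b) \/ (c != 0 /\ -1 <= b / c ^+ 2 <= 3^-1).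
Proof.
move=> real.
have lo : - c ^+ 2 <= b.
  rewrite leNgt; apply/negP => bc.
  have c2 := sqr_ge0 c; have b0 : b < 0 by lra.
  have bc0 : b + c ^+ 2 < 0 by lra.
  (* For b < -c^2 domination means k > t. The choice k = 1 + t satisfies it, and t >= 1 gives the
     discriminant condition c^2 < -4 b t. *)
  pose t := b / (b + c ^+ 2).
  have tE : t * (b + c ^+ 2) = b by rewrite divfK // lt_eqF.
  have t1 : 1 <= t by nra.
  apply: (@not_real_of_kappa R b c (1 + t)) => //.
  - by rewrite lt_eqF.
  - lra.
  - nra.
  - rewrite -subr_gt0.
    have -> : 1 + t - (1 - c ^+ 2 * (1 + t) / b) = (t * (b + c ^+ 2) + c ^+ 2) / b.
      by field; rewrite lt_eqF.
    by rewrite tE ltr_ndivlMr // mul0r addrC; lra.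
  - by apply/orP; right; apply/eqP; lra.
have [c0|c0] := eqVneq c 0; first by left; split=> //; rewrite c0 expr0n oppr0 in lo.
have c2 : 0 < c ^+ 2 by rewrite exprn_even_gt0.
right; split=> //; rewrite ler_pdivlMr // ler_pdivrMr // mulN1r lo /=.
rewrite leNgt; apply/negP => bc.
have b0 : 0 < b by lra.
(* For b > 0 domination means k > x and the discriminant condition means k < y. Both x < y and x >
   1/4 follow from 3 b > c^2; k is the midpoint. *)
pose x := b / (b + c ^+ 2); pose y := 1 - c ^+ 2 / (4 * b).
have xE : x * (b + c ^+ 2) = b by rewrite divfK // gt_eqF // addr_gt0.
have yE : y * (4 * b) = 4 * b - c ^+ 2 by rewrite /y; field; rewrite gt_eqF.
have bc0 : 0 < b + c ^+ 2 by rewrite addr_gt0.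
have xy : x < y.
  rewrite -subr_gt0 -(pmulr_lgt0 _ (mulr_gt0 bc0 b0)).
  have -> : (y - x) * ((b + c ^+ 2) * b) =
      (y * (4 * b) * (b + c ^+ 2) - x * (b + c ^+ 2) * (4 * b)) / 4 by field.
  rewrite xE yE divr_gt0 //.
  have -> : (4 * b - c ^+ 2) * (b + c ^+ 2) - b * (4 * b) =
      c ^+ 2 * (3 * b - c ^+ 2) by ring.
  by rewrite mulr_gt0 //; lra.
have x4 : 4^-1 < x.
  by rewrite -subr_gt0 -(pmulr_lgt0 _ bc0) mulrBl xE; lra.
have yb : x * (b + c ^+ 2) < y * (b + c ^+ 2) by rewrite ltr_pM2r.
have xb : x * (4 * b) < y * (4 * b) by rewrite ltr_pM2r // mulr_gt0.
apply: (@not_real_of_kappa R b c ((x + y) / 2)) => //.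
- by rewrite gt_eqF.
- lra.
- by rewrite yE in xb; lra.
- rewrite -subr_gt0.
  have -> : (x + y) / 2 - (1 - c ^+ 2 * ((x + y) / 2) / b) =
      ((x + y) / 2 * (b + c ^+ 2) - b) / b by field; rewrite gt_eqF.
  by apply: divr_gt0 => //; lra.
- by rewrite c0.
Qed.

Local Close Scope complex_scope.

(** * Sufficiency: sign changes along the conjugate pair *)

Lemma sin_cos_natpi (R : realType) (k : nat) :
  sin (k%:R * pi) = 0 :> R /\ cos (k%:R * pi) = (-1) ^+ k :> R.
Proof.
elim: k => [|k [IHs IHc]]; first by rewrite mul0r sin0 cos0.
by rewrite -natr1 mulrDl mul1r sinDpi cosDpi IHs IHc exprS mulN1r oppr0.
Qed.

(** The triple-angle formula at pi reads (x + 1)(2 x - 1)^2 = 0, and x > 0 selects 1/2. *)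
Lemma cos_pi3 (R : realType) : cos (pi / 3) = 2^-1 :> R.
Proof.
pose x : R := cos (pi / 3).
have p0 : 0 < pi :> R := pi_gt0 R.
have x0 : 0 < x.
  by apply: cos_gt0_pihalf; apply/andP; split; lra.
have : (x + 1) * (2 * x - 1) ^+ 2 = 0.
  have : cos (pi / 3 + (pi / 3 + pi / 3)) = -1 :> R.
    by rewrite -[RHS]cospi; congr cos; field.
  rewrite cosD cosD sinD -/x; have := cos2Dsin2 (pi / 3 : R); rewrite -/x.
  move: (sin _) => y e e'.
  have -> : (x + 1) * (2 * x - 1) ^+ 2 =
    (x * (x * x - y * y) - y * (y * x + x * y) + 1) + 3 * x * (x ^+ 2 + y ^+ 2 - 1).
    by ring.
  by rewrite e; move: e'; rewrite [y * x]mulrC => ->; ring.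
move/eqP; rewrite mulf_eq0 sqrf_eq0 => /orP[] /eqP h; rewrite -/x; lra.
Qed.

Lemma cos_2pi3 (R : realType) : cos (2 * pi / 3) = - 2^-1 :> R.
Proof.
have -> : 2 * pi / 3 = (pi / 3) *+ 2 :> R by rewrite mulr2n; field.
by rewrite cos_mulr2n cos_pi3 mulr2n; field.
Qed.

(* z is attained at a real root s of the characteristic polynomial strictly
   dominated by the conjugate pair t exp(+-i th). *)
Definition conj_pair (R : realType) (b c th z : R) :=
  exists t s, [/\ 0 < t, `|s| < t, c = - (2 * t * cos th + s),
                  b = t ^+ 2 + 2 * t * s * cos th & z = - (t ^+ 2 * s)].

(** At th = k pi / (m+2) the middle term of [H_polar] vanishes, sin ((m+1) th) = (-1)^(k+1) sin th,
    and |s| < t makes t^(m+2) outweigh s^(m+2). *)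
Lemma H_sign (R : realType) (b c z : R) (k m : nat) :
  (0 < k < m.+2)%N -> conj_pair b c (k%:R * pi / m.+2%:R) z ->
  0 < (-1) ^+ k.+1 * (H b c m).[z].
Proof.
move=> /andP[k0 km]; set th := _ / _ => -[t [s [t0 st Ec Eb ->]]].
have pi0 := pi_gt0 R.
have m0 : 0 < m.+2%:R :> R by rewrite ltr0n.
have k0R : 0 < k%:R :> R by rewrite ltr0n.
have sin0 : 0 < sin th.
  apply: sin_gt0_pi; rewrite divr_gt0 ?mulr_gt0 //= ltr_pdivrMr //.
  by rewrite mulrC ltr_pM2l // ltr_nat.
have W0 : 0 < sin th * (t ^+ 2 - 2 * s * t * cos th + s ^+ 2).
  rewrite mulr_gt0 //.
  have -> : t ^+ 2 - 2 * s * t * cos th + s ^+ 2 =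
    (t - s * cos th) ^+ 2 + s ^+ 2 * (1 - cos th ^+ 2) by ring.
  have c1 : 0 <= s ^+ 2 * (1 - cos th ^+ 2).
    apply: mulr_ge0; first exact: sqr_ge0.
    by have := cos2Dsin2 th; have := sqr_ge0 (sin th); lra.
  apply: ltr_pwDl c1.
  rewrite exprn_even_gt0 //= subr_eq0 gt_eqF //.
  apply: (le_lt_trans (ler_norm _)); rewrite normrM.
  by apply: (le_lt_trans _ st); rewrite ler_piMr ?cos_max.
have HP := H_polar _ _ _ _ _ _ m Ec Eb.
rewrite -(pmulr_lgt0 _ W0) -[ltRHS]mulrA HP.
have thE : m.+2%:R * th = k%:R * pi by rewrite /th mulrC divfK ?gt_eqF.
have [sk ck] := sin_cos_natpi R k.
have -> : m.+1%:R * th = k%:R * pi - th by rewrite -thE -[m.+2%:R]natr1; ring.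
rewrite sinB thE sk ck.
have -> : (-1) ^+ k.+1 * (t ^+ m.+2 * (0 * cos th - (-1) ^+ k * sin th)
     - s * t ^+ m.+1 * 0 + s ^+ m.+2 * sin th) =
   (t ^+ m.+2 * ((-1) ^+ k * (-1) ^+ k) - (-1) ^+ k * s ^+ m.+2) * sin th.
  by rewrite [(-1) ^+ k.+1]exprS; ring.
rewrite -expr2 sqrr_sign mulr1 mulr_gt0 // subr_gt0.
apply: (le_lt_trans (ler_norm _)); rewrite normrM normr_sign mul1r normrX.
by rewrite ltrXn2r.
Qed.

Lemma roots_of_sign_changes (R : rcfType) (p : {poly R}) (x : nat -> R)
    (e N : nat) :
  (forall i, (i < N)%N -> x i < x i.+1) ->
  (forall i, (i <= N)%N -> 0 < (-1) ^+ (i + e) * p.[x i]) ->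
  exists rs : seq R, [/\ size rs = N, uniq rs, all (root p) rs &
    forall r, r \in rs -> x 0%N < r < x N].
Proof.
elim: N => [|N IH] mono sgn; first by exists [::].
have [i iN|i iN|rs [sz un rt bd]] := IH.
- by apply: mono; rewrite ltnS ltnW.
- by apply: sgn; rewrite leqW.
have lt := mono N (ltnSn N).
have s0 := sgn N (leqnSn N); have s1 := sgn N.+1 (leqnn _).
have [|r rin rp] := @poly_ivtoo R p (x N) (x N.+1) (ltW lt).
  rewrite -oppr_gt0 -mulrN; have := mulr_gt0 s0 s1.
  rewrite addSn exprS.
  have -> : (-1) ^+ (N + e) * p.[x N] * (-1 * (-1) ^+ (N + e) * p.[x N.+1]) =
    ((-1) ^+ (N + e)) ^+ 2 * (p.[x N] * - p.[x N.+1]) by ring.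
  by rewrite sqrr_sign mul1r.
move: rin; rewrite in_itv /= => /andP[r1 r2].
have x0N : x 0%N <= x N.
  elim: N mono {IH sgn sz bd lt s0 s1 r1 r2} => // N IHN mono.
  rewrite (le_trans (IHN _)) ?ltW ?mono // => i iN.
  by apply: mono; rewrite ltnS ltnW.
exists (r :: rs); split=> /=; rewrite ?sz ?un ?rt ?rp ?andbT //.
  by apply/negP => /bd /andP[_ /lt_trans/(_ r1)]; rewrite ltxx.
move=> y; rewrite inE => /orP[/eqP->|/bd /andP[-> yN]].
  by rewrite r2 (le_lt_trans x0N).
by rewrite (lt_trans yN).
Qed.

(** One root may be missing: the cofactor is then real of degree at most one, so its root is real
    too. *)
Lemma zeros_real_of_roots (R : realType) (p : {poly R}) (rs : seq R) :
  uniq rs -> all (root p) rs -> (size p <= (size rs).+2)%N -> zeros_real p.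
Proof.
move=> un rt sz p0 z.
have [q pE] : exists q, p = q * \prod_(r <- rs) ('X - r%:P).
  by apply: uniq_roots_prod_XsubC; rewrite ?uniq_rootsE.
have q0 : q != 0 by apply: contraNneq p0 => q0; rewrite pE q0 mul0r.
have sq : (size q <= 2)%N.
  move: sz; rewrite pE size_Mmonic ?monic_prod_XsubC // size_prod_XsubC.
  by rewrite addnS /= -addn2 addnC leq_add2l.
rewrite pE rmorphM rootM => /orP[|].
  rewrite rootE; have -> : q = (q`_0)%:P + (q`_1) *: 'X.
    apply/polyP => -[|[|i]]; rewrite coefD coefC coefZ coefX /= ?mulr0 ?addr0 ?mulr1 ?add0r //.
    by rewrite nth_default // (leq_trans sq).
  rewrite rmorphD /= map_polyZ map_polyC map_polyX !hornerE.
  case: z => x y; rewrite eq_complex /= => /andP[/eqP re /eqP im].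
  have /eqP : q`_1 * y = 0 by rewrite -[RHS]im; ring.
  rewrite mulf_eq0 => /orP[/eqP q1|/eqP //].
  case/negP: q0; apply/eqP/polyP => i; rewrite coef0.
  case: i => [|[|i]] //; last by rewrite nth_default // (leq_trans sq).
  by rewrite -[RHS]re q1; ring.
rewrite rmorph_prod; elim: rs {un rt sz pE} => [|r rs IH] /=.
  by rewrite big_nil (negPf (root1 _)).
rewrite big_cons rootM => /orP[|/IH //].
by rewrite map_polyXsubC root_XsubC => /eqP ->.
Qed.

Lemma root_mem_of_size (R : idomainType) (p : {poly R}) (rs : seq R) (x : R) :
  uniq rs -> all (root p) rs -> (size p <= (size rs).+1)%N -> p != 0 ->
  root p x -> x \in rs.
Proof.
move=> un rt sz p0 px; apply: contraT => xrs.
have := @max_poly_roots R p (x :: rs) p0.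
by rewrite /= px rt xrs un ltnNge sz => /(_ isT isT).
Qed.

Lemma exists_consecutive_multiples (R : realType) (x y : R) :
  0 <= x -> x < y -> y <= pi ->
  exists m k : nat, [/\ (0 < k)%N, (k.+1 < m.+2)%N,
    x < k%:R * pi / m.+2%:R & k.+1%:R * pi / m.+2%:R < y].
Proof.
move=> x0 xy ypi; have pi0 := pi_gt0 R.
(* This makes the spacing pi / (m+2) less than (y - x) / 2, leaving room for two consecutive
   multiples. *)
pose m := Num.bound (2 * pi / (y - x)).
have yx : 0 < y - x by rewrite subr_gt0.
have mP : 2 * pi / (y - x) < m%:R.
  by apply: archi_boundP; rewrite divr_ge0 ?ltW // mulr_gt0.
have M0 : 0 < m.+2%:R :> R by rewrite ltr0n.
have mP' : 2 * pi < m.+2%:R * (y - x).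
  rewrite -ltr_pdivrMr // (lt_le_trans mP) // ler_nat; lia.
pose j := Num.truncn (x * m.+2%:R / pi).
have /andP[j1 j2] : (j%:R <= x * m.+2%:R / pi < j.+1%:R).
  by apply: truncn_itv; rewrite divr_ge0 ?mulr_ge0 // ltW.
rewrite ler_pdivlMr // in j1; rewrite ltr_pdivrMr // in j2.
have h2 : j.+2%:R * pi / m.+2%:R < y.
  rewrite ltr_pdivrMr // -[j.+2]addn2 natrD; nra.
exists m, j.+1; split=> //; last by rewrite ltr_pdivlMr.
have := lt_le_trans h2 ypi.
by rewrite ltr_pdivrMr // mulrC ltr_pM2l // ltr_nat.
Qed.

(** Consecutive angles give opposite signs of H_m at two points of (A, B). The order of these points
    is left open, since z decreases with th for c = 0 and increases for c = 1. *)
Lemma exists_zero_between (R : realType) (b c x y A B : R) :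
  0 <= x -> x < y -> y <= pi ->
  (forall th, x < th < y -> exists z, conj_pair b c th z) ->
  (forall th z, x < th < y -> conj_pair b c th z -> A < z < B) ->
  exists2 r, union_zeros b c r & A < r < B.
Proof.
move=> x0 xy ypi ex bd.
have [m [k [k0 km xk ky]]] := exists_consecutive_multiples x0 xy ypi.
have M0 : 0 < m.+2%:R :> R by rewrite ltr0n.
have kk : k%:R * pi / m.+2%:R < k.+1%:R * pi / m.+2%:R :> R.
  by rewrite ltr_pM2r ?invr_gt0 // ltr_pM2r ?pi_gt0 // ltr_nat.
have i1 : x < k%:R * pi / m.+2%:R < y by rewrite xk (lt_trans kk).
have i2 : x < k.+1%:R * pi / m.+2%:R < y by rewrite ky (lt_trans xk).
have [z1 c1] := ex _ i1; have [z2 c2] := ex _ i2.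
have /andP[a1 b1] := bd _ _ i1 c1; have /andP[a2 b2] := bd _ _ i2 c2.
have s1 : 0 < (-1) ^+ k.+1 * (H b c m).[z1].
  by apply: H_sign c1; rewrite k0 (ltn_trans (ltnSn k)).
have s2 : 0 < (-1) ^+ k.+2 * (H b c m).[z2] by apply: H_sign c2; rewrite km.
have p0 : H b c m != 0.
  by apply: contraTneq s1 => ->; rewrite horner0 mulr0 ltxx.
have opp : (H b c m).[z1] * (H b c m).[z2] < 0.
  rewrite -oppr_gt0 -mulrN; have := mulr_gt0 s1 s2.
  rewrite [(-1) ^+ k.+2]exprS.
  have -> : (-1) ^+ k.+1 * (H b c m).[z1] * (-1 * (-1) ^+ k.+1 * (H b c m).[z2]) =
    ((-1) ^+ k.+1) ^+ 2 * ((H b c m).[z1] * - (H b c m).[z2]) by ring.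
  by rewrite sqrr_sign mul1r.
have [z12|z21] := leP z1 z2.
  have [r] := poly_ivtoo z12 opp; rewrite in_itv /= => /andP[r1 r2] rp.
  by exists r; [exists m | rewrite (lt_trans a1) // (lt_trans r2)].
rewrite mulrC in opp; have [r] := poly_ivtoo (ltW z21) opp.
rewrite in_itv /= => /andP[r1 r2] rp.
by exists r; [exists m | rewrite (lt_trans a2) // (lt_trans r2)].
Qed.

(** The pair is nonreal, so s is the only real root of F at z. It determines t^2 = s^2 + c s + b,
    and then cos th. *)
Lemma conj_pair_inj (R : realType) (b c th th' z : R) :
  0 < th < pi -> 0 < th' < pi ->
  conj_pair b c th z -> conj_pair b c th' z -> th = th'.
Proof.
move=> thI thI' [t [s [t0 st Ec Eb ->]]] [t' [s' [t0' st' Ec' Eb' Ez]]].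
have ss : s' = s.
  have : (s' - s) * ((s' - t * cos th) ^+ 2 + t ^+ 2 * (1 - cos th ^+ 2)) = 0.
    have -> : (s' - s) * ((s' - t * cos th) ^+ 2 + t ^+ 2 * (1 - cos th ^+ 2)) =
      s' ^+ 3 + (- (2 * t * cos th + s)) * s' ^+ 2
      + (t ^+ 2 + 2 * t * s * cos th) * s' - t ^+ 2 * s by ring.
    by rewrite -Ec -Eb Ez Ec' Eb'; ring.
  move/eqP; rewrite mulf_eq0 subr_eq0 => /orP[/eqP //|].
  have s0 := sin_gt0_pi thI.
  have -> : 1 - cos th ^+ 2 = sin th ^+ 2 by have := cos2Dsin2 th; lra.
  rewrite gt_eqF // ltr_wpDl ?sqr_ge0 // mulr_gt0 // exprn_gt0 //.
subst s'.
have tt : t = t'.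
  have : t ^+ 2 = t' ^+ 2.
    have -> : t ^+ 2 = s ^+ 2 + c * s + b by rewrite Ec Eb; ring.
    by rewrite Ec' Eb'; ring.
  by move/eqP; rewrite eqrXn2 ?(ltW t0) ?(ltW t0') // => /eqP.
subst t'.
have cc : cos th = cos th'.
  have e : 2 * t * cos th = 2 * t * cos th' by lra.
  by apply: (mulfI _ e); rewrite mulf_neq0 // gt_eqF.
move: thI thI' => /andP[? ?] /andP[? ?].
by apply: (cos_inj _ _ cc); rewrite in_itv /= !ltW.
Qed.

(** * The map from angles to z for c = 0 *)

Lemma conj_pair0_exists (R : realType) (b th : R) :
  0 < b -> pi / 3 < th < 2 * pi / 3 -> exists z, conj_pair b 0 th z.
Proof.
move=> b0 /andP[th1 th2]; have p0 : 0 < pi :> R := pi_gt0 R.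
have x1 : cos th < 2^-1.
  rewrite -cos_pi3 ltr_cos // in_itv /=; apply/andP; split; lra.
have x2 : - 2^-1 < cos th.
  rewrite -cos_2pi3 ltr_cos // in_itv /=; apply/andP; split; lra.
have d0 : 0 < 1 - 4 * cos th ^+ 2 by nra.
(* Here s = -2 t cos th, so |s| < t means |cos th| < 1/2, and b = t^2 (1 - 4 cos^2 th) fixes t. *)
pose t := Num.sqrt (b / (1 - 4 * cos th ^+ 2)).
have t0 : 0 < t by rewrite sqrtr_gt0 divr_gt0.
have tE : t ^+ 2 * (1 - 4 * cos th ^+ 2) = b.
  by rewrite sqr_sqrtr ?divfK ?gt_eqF // divr_ge0 // ltW.
exists (- (t ^+ 2 * (- (2 * t * cos th)))), t, (- (2 * t * cos th)); split=> //.
- by rewrite ltr_norml; apply/andP; split; nra.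
- by rewrite subrr oppr0.
- by rewrite -tE; ring.
Qed.

(** Both z = -(s^3 + b s) and cos th = -s / (2 sqrt (s^2 + b)) are strictly decreasing in s. *)
Lemma conj_pair0_mono (R : realType) (b th th' z z' : R) :
  0 < b -> 0 < th < pi -> 0 < th' < pi ->
  conj_pair b 0 th z -> conj_pair b 0 th' z' -> z < z' -> th' < th.
Proof.
move=> b0 /andP[h1 h2] /andP[h1' h2'] [t [s [t0 _ Ec Eb ->]]]
  [t' [s' [t0' _ Ec' Eb' ->]]] zz.
rewrite -(@ltr_cos _ th' th) ?in_itv /= ?(ltW h1) ?(ltW h2) ?(ltW h1') ?(ltW h2') //.
have sE : s = - (2 * t * cos th) by lra.
have sE' : s' = - (2 * t' * cos th') by lra.
have tE : t ^+ 2 = b + s ^+ 2 by rewrite Eb sE; ring.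
have tE' : t' ^+ 2 = b + s' ^+ 2 by rewrite Eb' sE'; ring.
have ss : s' < s.
  rewrite ltNge; apply/negP => le; move: zz; rewrite tE tE'; apply/negP.
  rewrite -leNgt lerN2 -subr_ge0.
  have -> : (b + s' ^+ 2) * s' - (b + s ^+ 2) * s =
    (s' - s) * (b + (s' + s / 2) ^+ 2 + 3 / 4 * s ^+ 2) by field.
  rewrite mulr_ge0 ?subr_ge0 // !addr_ge0 ?sqr_ge0 ?(ltW b0) //.
  by rewrite mulr_ge0 ?sqr_ge0 // divr_ge0.
suff : s' * t < s * t'.
  rewrite sE sE' -subr_gt0.
  have -> : - (2 * t * cos th) * t' - - (2 * t' * cos th') * t =
    (cos th' - cos th) * (2 * t * t') by ring.
  by rewrite pmulr_lgt0 ?mulr_gt0 // subr_gt0.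
have sq (p q t1 t2 : R) : 0 <= p -> p < q -> 0 < t1 -> 0 < t2 ->
    t1 ^+ 2 = b + p ^+ 2 -> t2 ^+ 2 = b + q ^+ 2 -> p * t2 < q * t1.
  move=> hp pq ht1 ht2 e1 e2.
  have hq : 0 <= q by rewrite (le_trans hp) // ltW.
  rewrite -(@ltr_pXn2r _ 2) ?nnegrE ?mulr_ge0 ?(ltW ht1) ?(ltW ht2) //.
  rewrite !exprMn e1 e2 -subr_gt0.
  have -> : q ^+ 2 * (b + p ^+ 2) - p ^+ 2 * (b + q ^+ 2) = b * (q - p) * (q + p) by ring.
  by rewrite !mulr_gt0 ?subr_gt0 // ltr_wpDr // (le_lt_trans hp).
have [s0'|s0'] := leP 0 s'; first exact: sq.
have [s0|s0] := leP 0 s.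
  by apply: (@lt_le_trans _ _ 0); [rewrite nmulr_rlt0 | rewrite mulr_ge0 // ltW].
rewrite -ltrN2 -!mulNr; apply: sq; rewrite ?sqrrN ?ltrN2 //.
by rewrite oppr_ge0 ltW.
Qed.

Lemma conj_pair0_surj (R : realType) (b z : R) :
  0 < b -> exists2 th, pi / 3 < th < 2 * pi / 3 & conj_pair b 0 th z.
Proof.
move=> b0; have p0 : 0 < pi :> R := pi_gt0 R.
pose p : {poly R} := 'X^3 + b *: 'X + z%:P.
have pE x : p.[x] = x ^+ 3 + b * x + z by rewrite /p !hornerE.
(* As b B > |z|, the cubic changes sign on [-B, B]; its root there serves as s. *)
pose B := `|z| / b + 1.
have B0 : 0 < B by rewrite ltr_wpDl // divr_ge0 // ltW.
have bB : b * B = `|z| + b by rewrite /B; field; rewrite gt_eqF.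
have z1 := ler_norm z; have z2 := ler_norm (- z); rewrite normrN in z2.
have B3 : 0 < B ^+ 3 by rewrite exprn_gt0.
have [||s _ /eqP] := @poly_ivtoo R p (- B) B.
- lra.
- rewrite nmulr_rlt0 pE; first by lra.
  have -> : (- B) ^+ 3 + b * - B = - (B ^+ 3 + b * B) by ring.
  by lra.
rewrite pE => sE.
pose t := Num.sqrt (s ^+ 2 + b).
have t0 : 0 < t by rewrite sqrtr_gt0 ltr_wpDl ?sqr_ge0.
have tE : t ^+ 2 = s ^+ 2 + b by rewrite sqr_sqrtr // addr_ge0 ?sqr_ge0 // ltW.
have st : `|s| < t.
  rewrite -(@ltr_pXn2r _ 2) ?nnegrE ?(ltW t0) // real_normK ?num_real // tE.
  by rewrite ltrDl.
have := st; rewrite ltr_norml => /andP[st1 st2].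
pose x := - s / (2 * t).
have xE : 2 * t * x = - s by rewrite /x; field; rewrite gt_eqF.
have x1 : - 2^-1 < x by nra.
have x2 : x < 2^-1 by nra.
have xI : x \in `[-1, 1] by rewrite in_itv /=; apply/andP; split; lra.
have cE : cos (acos x) = x by rewrite acosK.
have /andP[a0 api] : 0 <= acos x <= pi by rewrite acos_ge0 ?acos_lepi.
exists (acos x).
  apply/andP; split; rewrite -(@ltr_cos R) ?in_itv /= ?a0 ?api ?cE ?cos_pi3 ?cos_2pi3 //.
    by apply/andP; split; lra.
  by apply/andP; split; lra.
exists t, s; rewrite cE; split=> //; first by rewrite xE addNr oppr0.
  have -> : 2 * t * s * x = s * (2 * t * x) by ring.
  by rewrite xE tE; ring.
have -> : z = - (s ^+ 3 + b * s) by lra.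
by rewrite tE; ring.
Qed.

(** * The map from angles to z for c = 1 *)

Lemma conj_pair1_exists (R : realType) (a th : R) :
  -1 <= a <= 3^-1 -> 2 * pi / 3 < th < pi -> exists z, conj_pair a 1 th z.
Proof.
move=> /andP[a1 a2] /andP[th1 th2]; have p0 : 0 < pi :> R := pi_gt0 R.
pose y := - cos th.
have y1 : 2^-1 < y.
  have : cos th < - 2^-1 by rewrite -cos_2pi3 ltr_cos // in_itv /=; apply/andP; split; lra.
  rewrite /y; lra.
have y2 : y < 1.
  have : -1 < cos th by rewrite -cospi ltr_cos // in_itv /=; apply/andP; split; lra.
  rewrite /y; lra.
have d0 : 0 < 4 * y ^+ 2 - 1 by nra.
(* Substituting s = 2 t y - 1 gives (4 y^2 - 1) t^2 - 2 y t + a = 0, with quarter discriminant D; t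
   is the larger root. The bound a <= 1/3 gives D >= 0, and a >= -1 gives q < y + 1, needed for s <
   t. *)
pose D := y ^+ 2 - a * (4 * y ^+ 2 - 1).
have D0 : 0 <= D by rewrite /D; nra.
pose q := Num.sqrt D; have q0 : 0 <= q by rewrite sqrtr_ge0.
have qE : q ^+ 2 = D by rewrite sqr_sqrtr.
have q1 : q < y + 1.
  rewrite -(@ltr_pXn2r _ 2) ?nnegrE //; last by lra.
  by rewrite qE /D; nra.
pose t := (y + q) / (4 * y ^+ 2 - 1).
have t0 : 0 < t by rewrite divr_gt0 //; lra.
have tE : t * (4 * y ^+ 2 - 1) = y + q by rewrite divfK // gt_eqF.
have t1 : t * (2 * y - 1) < 1.
  have : t * (2 * y - 1) * (2 * y + 1) < 2 * y + 1.
    have -> : t * (2 * y - 1) * (2 * y + 1) = t * (4 * y ^+ 2 - 1) by ring.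
    by rewrite tE; lra.
  by rewrite -ltr_pdivlMr ?divff //; [rewrite gt_eqF//; lra | lra].
have t2 : 1 < t * (2 * y + 1).
  have : 2 * y - 1 < t * (2 * y + 1) * (2 * y - 1).
    have -> : t * (2 * y + 1) * (2 * y - 1) = t * (4 * y ^+ 2 - 1) by ring.
    by rewrite tE; lra.
  by rewrite -ltr_pdivrMr ?divff //; [rewrite gt_eqF//; lra | lra].
have cE : cos th = - y by rewrite opprK.
exists (- (t ^+ 2 * (2 * t * y - 1))), t, (2 * t * y - 1).
rewrite cE; split=> //.
- by rewrite ltr_norml; apply/andP; split; lra.
- ring.
have : (t * (4 * y ^+ 2 - 1) - y) ^+ 2 = D by rewrite tE -qE; ring.
rewrite /D => /eqP; rewrite -subr_eq0.
have -> : (t * (4 * y ^+ 2 - 1) - y) ^+ 2 - (y ^+ 2 - a * (4 * y ^+ 2 - 1)) =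
  (4 * y ^+ 2 - 1) * (a - (t ^+ 2 + 2 * t * (2 * t * y - 1) * - y)) by ring.
by rewrite mulf_eq0 (gt_eqF d0) /= subr_eq0 => /eqP.
Qed.

(* x = 3 s + 1 depresses the cubic; x = 2 u corresponds to the pair merging
   into a double root. *)
Lemma conj_pair1_depressed (R : realType) (a u th z : R) :
  0 <= u -> a = (1 - u ^+ 2) / 3 -> 2 * pi / 3 < th < pi ->
  conj_pair a 1 th z -> exists x,
  [/\ 2 * u < x, - 27 * z = x ^+ 3 - 3 * u ^+ 2 * x + 2 - 9 * a,
      0 <= - cos th,
      0 < ((x - 1) / 3) ^+ 2 + (x - 1) / 3 + a &
      4 * cos th ^+ 2 * (((x - 1) / 3) ^+ 2 + (x - 1) / 3 + a) = ((x + 2) / 3) ^+ 2].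
Proof.
move=> u0 aE thI [t [s [t0 st Ec Eb ->]]].
have p0 : 0 < pi :> R := pi_gt0 R.
move/andP: thI => [th1 th2].
have c0 : cos th < - 2^-1.
  by rewrite -cos_2pi3 ltr_cos // in_itv /=; apply/andP; split; lra.
have c1 : -1 < cos th.
  by rewrite -cospi ltr_cos // in_itv /=; apply/andP; split; lra.
have sE : 1 + s = - (2 * t * cos th) by lra.
have tE : t ^+ 2 = s ^+ 2 + s + a.
  rewrite Eb; have -> : 2 * t * s * cos th = s * (2 * t * cos th) by ring.
  have -> : 2 * t * cos th = - 1 - s by lra.
  by ring.
exists (3 * s + 1).
have x1E : (3 * s + 1 - 1) / 3 = s by field.
have x2E : (3 * s + 1 + 2) / 3 = 1 + s by field.
rewrite x1E x2E -tE; split.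
(* From |s| < t follows s + a > 0, that is x > u^2 >= 0. This selects the branch x > 2 u of x^2 > 4
   u^2, the latter expressing that the pair is nonreal. *)
- have sa : 0 < s + a.
    have : s ^+ 2 < t ^+ 2.
      by rewrite -(@real_normK _ s) ?num_real // ltr_pXn2r ?nnegrE ?(ltW t0).
    by rewrite tE; lra.
  have disc : 0 < (3 * s + 1) ^+ 2 - 4 * u ^+ 2.
    have -> : (3 * s + 1) ^+ 2 - 4 * u ^+ 2 = 3 * (4 * (s ^+ 2 + s + a) - (1 + s) ^+ 2).
      by rewrite aE; field.
    rewrite mulr_gt0 // -tE sE subr_gt0.
    have -> : (- (2 * t * cos th)) ^+ 2 = 4 * t ^+ 2 * cos th ^+ 2 by ring.
    rewrite gtr_pMr ?mulr_gt0 ?exprn_gt0 //; nra.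
  have x0 : 0 <= 3 * s + 1 by have := sqr_ge0 u; lra.
  rewrite -(@ltr_pXn2r _ 2) ?nnegrE ?mulr_ge0 // exprMn; lra.
- by rewrite tE aE; field.
- lra.
- exact: exprn_gt0.
by rewrite sE; ring.
Qed.

Lemma depressed_mono (R : realFieldType) (u x y : R) :
  0 <= u -> 2 * u < x -> 2 * u <= y ->
  (y ^+ 3 - 3 * u ^+ 2 * y < x ^+ 3 - 3 * u ^+ 2 * x) = (y < x).
Proof.
move=> u0 ux uy; rewrite -subr_gt0.
have -> : x ^+ 3 - 3 * u ^+ 2 * x - (y ^+ 3 - 3 * u ^+ 2 * y) =
  (x - y) * (x ^+ 2 + x * y + y ^+ 2 - 3 * u ^+ 2) by ring.
rewrite pmulr_lgt0 ?subr_gt0 //; nra.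
Qed.

(** z decreases in x on x >= 2 u, and the bound is its value at x = 2 u. *)
Lemma conj_pair1_lt (R : realType) (a u th z : R) :
  0 <= u -> a = (1 - u ^+ 2) / 3 -> 2 * pi / 3 < th < pi ->
  conj_pair a 1 th z -> z < (-2 + 9 * a - 2 * u ^+ 3) / 27.
Proof.
move=> u0 aE thI /(conj_pair1_depressed u0 aE thI)[x [ux zE _ _ _]].
have := depressed_mono u0 ux (lexx _); rewrite ux => mono.
have -> : z = - (x ^+ 3 - 3 * u ^+ 2 * x + 2 - 9 * a) / 27 by lra.
have e : (2 * u) ^+ 3 - 3 * u ^+ 2 * (2 * u) = 2 * u ^+ 3 by ring.
rewrite e in mono; lra.
Qed.

(** A larger z means a smaller x, and 4 cos^2 th = v^2 / (v^2 - v + a) with v = (x + 2) / 3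
    decreases in v: v v' > a (v + v') because v, v' > 2 w and a <= w for w = (1 + u) / 3. *)
Lemma conj_pair1_mono (R : realType) (a u th th' z z' : R) :
  0 <= u -> a = (1 - u ^+ 2) / 3 ->
  2 * pi / 3 < th < pi -> 2 * pi / 3 < th' < pi ->
  conj_pair a 1 th z -> conj_pair a 1 th' z' -> z < z' -> th < th'.
Proof.
move=> u0 aE thI thI' cz cz' zz.
have [x [ux zE y0 T0 yE]] := conj_pair1_depressed u0 aE thI cz.
have [x' [ux' zE' y0' T0' yE']] := conj_pair1_depressed u0 aE thI' cz'.
have xx : x' < x by rewrite -(depressed_mono u0 ux (ltW ux')); lra.
have p0 : 0 < pi :> R := pi_gt0 R.
move: thI thI' => /andP[h1 h2] /andP[h1' h2'].
rewrite -(@ltr_cos _ th th'); last 2 first.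
- by rewrite in_itv /=; apply/andP; split; lra.
- by rewrite in_itv /=; apply/andP; split; lra.
rewrite -ltrN2 -(@ltr_pXn2r _ 2) ?nnegrE // !sqrrN.
move: T0 T0' yE yE'; set T := _ + a; set T' := _ + a => T0 T0' yE yE'.
rewrite -(ltr_pM2r (mulr_gt0 T0 T0')) -subr_gt0.
have -> : cos th' ^+ 2 * (T * T') - cos th ^+ 2 * (T * T') =
  (4 * cos th' ^+ 2 * T' * T - 4 * cos th ^+ 2 * T * T') / 4 by field.
rewrite yE yE' divr_gt0 //.
pose v := (x + 2) / 3; pose v' := (x' + 2) / 3.
have TE : T = v ^+ 2 - v + a by rewrite /T /v; field.
have TE' : T' = v' ^+ 2 - v' + a by rewrite /T' /v'; field.
rewrite -/v -/v' TE TE'.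
have -> : v' ^+ 2 * (v ^+ 2 - v + a) - v ^+ 2 * (v' ^+ 2 - v' + a) =
  (v - v') * (v * v' - a * (v + v')) by ring.
apply: mulr_gt0; first by rewrite /v /v'; lra.
pose w := (1 + u) / 3.
have w0 : 0 < w by rewrite /w; lra.
have vw : 2 * w < v by rewrite /v /w; lra.
have vw' : 2 * w < v' by rewrite /v' /w; lra.
have aw : a <= w by rewrite aE /w; have := sqr_ge0 u; lra.
have : a * (v + v') <= w * (v + v') by rewrite ler_wpM2r //; lra.
nra.
Qed.

Lemma conj_pair1_surj (R : realType) (a u z : R) :
  0 <= u <= 2 -> a = (1 - u ^+ 2) / 3 -> z < (-2 + 9 * a - 2 * u ^+ 3) / 27 ->
  exists2 th, 2 * pi / 3 < th < pi & conj_pair a 1 th z.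
Proof.
move=> /andP[u0 u2] aE zu; have p0 : 0 < pi :> R := pi_gt0 R.
pose r := - 27 * z - 2 + 9 * a.
have ru : 2 * u ^+ 3 < r by rewrite /r; lra.
pose p : {poly R} := 'X^3 - (3 * u ^+ 2) *: 'X - r%:P.
have pE x : p.[x] = x ^+ 3 - 3 * u ^+ 2 * x - r by rewrite /p !hornerE.
have r0 : 0 < r by apply: le_lt_trans ru; rewrite mulr_ge0 ?exprn_ge0.
pose B := 2 * u + r + 1.
have [||x] := @poly_ivtoo R p (2 * u) B.
- rewrite /B; lra.
- rewrite nmulr_rlt0 pE.
    have -> : B ^+ 3 - 3 * u ^+ 2 * B - r = B * (B ^+ 2 - 3 * u ^+ 2 - 1) + (B - r) by ring.
    have B1 : 2 * u + 1 <= B by rewrite /B; lra.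
    by rewrite ltr_wpDl //; [rewrite mulr_ge0 //; nra | rewrite /B; lra].
  have -> : (2 * u) ^+ 3 - 3 * u ^+ 2 * (2 * u) - r = 2 * u ^+ 3 - r by ring.
  by lra.
rewrite in_itv /= => /andP[ux _] /eqP; rewrite pE => xE.
pose s := (x - 1) / 3.
have xs : x = 3 * s + 1 by rewrite /s; field.
(* s + a = (x - u^2) / 3 > u (2 - u) / 3 >= 0, by u <= 2. This is t^2 > s^2. *)
have sa : 0 < s + a by rewrite /s aE; nra.
have T0 : 0 < s ^+ 2 + s + a by rewrite -addrA ltr_wpDl ?sqr_ge0.
pose t := Num.sqrt (s ^+ 2 + s + a).
have t0 : 0 < t by rewrite sqrtr_gt0.
have tE : t ^+ 2 = s ^+ 2 + s + a by rewrite sqr_sqrtr // ltW.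
have st : `|s| < t.
  rewrite -(@ltr_pXn2r _ 2) ?nnegrE ?(ltW t0) // real_normK ?num_real // tE; lra.
have s1 : 0 < 1 + s by rewrite /s; lra.
pose y := - (1 + s) / (2 * t).
have yE : 2 * t * y = - (1 + s) by rewrite /y; field; rewrite gt_eqF.
have disc : (1 + s) ^+ 2 < (2 * t) ^+ 2.
  rewrite exprMn tE -subr_gt0.
  have -> : 2 ^+ 2 * (s ^+ 2 + s + a) - (1 + s) ^+ 2 = (x ^+ 2 - 4 * u ^+ 2) / 3.
    by rewrite aE /s; field.
  by rewrite divr_gt0 //; nra.
have d1 : 1 + s < 2 * t.
  by move: disc; rewrite ltr_pXn2r ?nnegrE ?mulr_ge0 ?(ltW t0) ?(ltW s1).
have d2 : t < 1 + s.
  rewrite -(@ltr_pXn2r _ 2) ?nnegrE ?(ltW t0) ?(ltW s1) // tE -subr_gt0.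
  have -> : (1 + s) ^+ 2 - (s ^+ 2 + s + a) = 1 + s - a by ring.
  by rewrite aE; have := sqr_ge0 u; lra.
have y1 : -1 < y by nra.
have y2 : y < - 2^-1 by nra.
have yI : y \in `[-1, 1] by rewrite in_itv /=; apply/andP; split; lra.
have cE : cos (acos y) = y by rewrite acosK.
have /andP[a0 api] : 0 <= acos y <= pi by rewrite acos_ge0 ?acos_lepi.
exists (acos y).
  apply/andP; split; rewrite -(@ltr_cos R) ?in_itv /= ?a0 ?api ?cE ?cospi ?cos_2pi3 //.
    by apply/andP; split; lra.
  by rewrite lexx ltW.
exists t, s; rewrite cE; split=> //; first by rewrite yE; ring.
  have -> : 2 * t * s * y = s * (2 * t * y) by ring.
  by rewrite yE tE; ring.
rewrite tE; have -> : z = - (r + 2 - 9 * a) / 27 by rewrite /r; lra.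
have -> : r = x ^+ 3 - 3 * u ^+ 2 * x by lra.
by rewrite aE xs; field.
Qed.

(** * Counting the real zeros of [H] *)

Lemma H_comp_scale (R : realType) (b c : R) (m : nat) : c != 0 ->
  H b c m \Po (c ^+ 3 *: 'X) = c ^+ m *: H (b / c ^+ 2) 1 m.
Proof.
move=> c0; have bE : b = b / c ^+ 2 * c ^+ 2 by rewrite divfK // expf_neq0.
rewrite [in LHS]bE; move: (b / _) => d {bE}.
elim/nat_ind3: m => [|||m IH0 IH1 IH2].
- by rewrite /= expr0 scale1r comp_polyC.
- by rewrite /= comp_polyC -mul_polyC -polyCM; congr _%:P; ring.
- by rewrite /= comp_polyC -mul_polyC -polyCM; congr _%:P; ring.
have compN (p q : {poly R}) : (- p) \Po q = - (p \Po q) by rewrite raddfN.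
rewrite !H_rec !comp_polyB compN !comp_polyZ comp_polyM comp_polyX IH0 IH1 IH2.
by rewrite -!mul_polyC !(polyC_exp, polyCM) polyC1 !exprS; ring.
Qed.

Lemma conj_pair_points (R : realType) (b c lo hi : R) (m : nat) :
  (forall th, lo < th < hi -> exists z, conj_pair b c th z) ->
  exists f : nat -> R, forall k : nat,
    let th := k%:R * pi / m.+2%:R in lo < th < hi -> conj_pair b c th (f k).
Proof.
move=> ex; suff /choice[f fP] : forall k : nat, exists z,
    lo < k%:R * pi / m.+2%:R < hi -> conj_pair b c (k%:R * pi / m.+2%:R) z.
  by exists f.
move=> k.
have [kI|kI] := boolP (lo < k%:R * pi / m.+2%:R < hi); last by exists 0.
by have [z cz] := ex _ kI; exists z.
Qed.

Lemma angle_range (R : realType) (p q k m : nat) :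
  (p * m.+2 < 3 * k < q * m.+2)%N ->
  (p%:R * pi / 3 : R) < k%:R * pi / m.+2%:R < (q%:R * pi / 3 : R).
Proof.
move=> /andP[pk kq]; have p0 : 0 < pi :> R := pi_gt0 R.
have m0 : 0 < m.+2%:R :> R by rewrite ltr0n.
rewrite ltr_pdivlMr // ltr_pdivrMr //.
have -> : p%:R * pi / 3 * m.+2%:R = (p * m.+2)%:R * pi / 3 :> R by rewrite natrM; ring.
have -> : q%:R * pi / 3 * m.+2%:R = (q * m.+2)%:R * pi / 3 :> R by rewrite natrM; ring.
rewrite ltr_pdivrMr // ltr_pdivlMr //.
have -> : k%:R * pi * 3 = (3 * k)%:R * pi :> R by rewrite natrM; ring.
by rewrite !ltr_pM2r // !ltr_nat pk.
Qed.

Lemma angle_ltS (R : realType) (k m : nat) :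
  k%:R * pi / m.+2%:R < k.+1%:R * pi / m.+2%:R :> R.
Proof.
by rewrite ltr_pM2r ?invr_gt0 ?ltr0n // ltr_pM2r ?pi_gt0 // ltr_nat.
Qed.

Lemma zeros_real_size_le1 (R : realType) (p : {poly R}) :
  (size p <= 1)%N -> zeros_real p.
Proof. by move=> sz; apply: (@zeros_real_of_roots R p [::]) => //; rewrite ltnW. Qed.

Lemma zeros_real_H00 (R : realType) (m : nat) : zeros_real (H (0 : R) 0 m).
Proof.
have [k ->] : exists k : R, H 0 0 m = k *: 'X^(m %/ 3).
  elim/nat_ind3: m => [|||m [k IH] _ _].
  - by exists 1; rewrite /= expr0 scale1r.
  - by exists 0; rewrite /= oppr0 scale0r.
  - by exists 0; rewrite /= expr0n oppr0 addr0 scale0r.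
  exists (- k); rewrite H_rec IH !scale0r !oppr0 !add0r.
  have -> : (m.+3 %/ 3 = (m %/ 3).+1)%N by lia.
  by rewrite exprS scaleNr scalerAr.
move=> kn0 z; rewrite map_polyZ map_polyXn.
have k0 : k != 0 by apply: contraNneq kn0 => ->; rewrite scale0r.
rewrite rootZ ?fmorph_eq0 // rootE hornerXn expf_eq0 => /andP[_ /eqP ->].
by [].
Qed.

Lemma conj_pair0_anti (R : realType) (b th th' z z' : R) :
  0 < b -> 0 < th < pi -> 0 < th' < pi ->
  conj_pair b 0 th z -> conj_pair b 0 th' z' -> th' < th -> z < z'.
Proof.
move=> b0 hI hI' cz cz' tt; case: (ltgtP z z') => // zz.
  by have := conj_pair0_mono b0 hI' hI cz' cz zz; rewrite ltNge (ltW tt).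
by move: tt; rewrite zz in cz; rewrite (conj_pair_inj hI hI' cz cz') ltxx.
Qed.

Lemma zeros_real_H0 (R : realType) (b : R) (m : nat) :
  0 <= b -> zeros_real (H b 0 m).
Proof.
rewrite le_eqVlt => /predU1P[<-|b0]; first exact: zeros_real_H00.
have [m3|m3] := ltnP m 3.
  apply: zeros_real_size_le1; rewrite (leq_trans (size_H _ _ _ _)) //; lia.
have p0 : 0 < pi :> R := pi_gt0 R.
have [f fP] := @conj_pair_points R b 0 (pi / 3) (2 * pi / 3) m
  (fun th => @conj_pair0_exists R b th b0).
(* The admissible indices run from [(m.+2 %/ 3).+1] to [K]. They are listed downwards from [K]
   because z decreases with the angle. *)
pose K := ((2 * m).+3 %/ 3)%N.
pose N := (K - (m.+2 %/ 3).+1)%N.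
have fK k : (m.+2 < 3 * k < 2 * m.+2)%N ->
    conj_pair b 0 (k%:R * pi / m.+2%:R) (f k) /\ (0 : R) < k%:R * pi / m.+2%:R < (pi : R).
  move=> kI; have := @angle_range R 1 2 k m; rewrite mul1n mul1r => /(_ kI) tI.
  split; first exact: fP.
  move/andP: tI => [h1 h2]; rewrite (lt_trans _ h1) ?divr_gt0 // (lt_trans h2) //.
  by lra.
have rg i : (i <= N)%N -> (m.+2 < 3 * (K - i) < 2 * m.+2)%N by rewrite /N /K; lia.
have [|i iN|rs [sz un rt _]] :=
  @roots_of_sign_changes R (H b 0 m) (fun i => f (K - i)%N) K.+1 N.
- move=> i iN.
  have [c1 t1] := fK _ (rg i (ltnW iN)); have [c2 t2] := fK _ (rg i.+1 iN).
  apply: (conj_pair0_anti b0 t1 t2 c1 c2).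
  have -> : (K - i = (K - i.+1).+1)%N by move: iN; rewrite /N /K; lia.
  exact: angle_ltS.
- have [c1 _] := fK _ (rg i iN).
  have -> : (-1) ^+ (i + K.+1) = (-1) ^+ (K - i).+1 :> R.
    rewrite -signr_odd -[RHS]signr_odd; congr (_ ^+ _).
    by move: iN; rewrite /N /K; lia.
  by apply: H_sign c1; have := rg i iN; lia.
(* [N] can be one less than m/3 rounded down, which the lemma tolerates. *)
apply: (@zeros_real_of_roots R _ rs) => //; rewrite sz.
by rewrite (leq_trans (size_H _ _ _ _)) // /N /K; lia.
Qed.

Lemma sign_at_minfty (R : realType) (p : {poly R}) (n e : nat) (y : R) :
  (size p <= n.+1)%N -> 0 < (-1) ^+ (n + e) * p`_n ->
  exists2 x, x < y & 0 < (-1) ^+ e * p.[x].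
Proof.
move=> sz pn.
have sp : size p = n.+1.
  apply/eqP; rewrite eqn_leq sz ltnNge; apply/negP => /leq_sizeP/(_ n (leqnn _)) E.
  by move: pn; rewrite E mulr0 ltxx.
pose q := (-1) ^+ e *: (p \Po (- 'X)).
have lq : 0 < lead_coef q.
  rewrite lead_coefZ lead_coef_comp ?size_polyN ?size_polyX //.
  rewrite lead_coefN lead_coefX sp /= lead_coefE sp /=.
  by move: pn; rewrite exprD => pn; rewrite mulrC -mulrA mulrC.
have [M HM] := poly_pinfty_gt_lc lq.
pose x := `|M| + `|y| + 1.
have h1 := ler_norm M; have h2 := ler_norm (- y); rewrite normrN in h2.
have h3 := normr_ge0 M; have h4 := normr_ge0 y.
exists (- x); first by rewrite /x; lra.
have := HM x; rewrite hornerZ horner_comp hornerN hornerX => le.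
apply: (lt_le_trans lq); apply: le.
by rewrite /x; lra.
Qed.

Lemma conj_pair1_incr (R : realType) (a u th th' z z' : R) :
  0 <= u -> a = (1 - u ^+ 2) / 3 ->
  2 * pi / 3 < th < pi -> 2 * pi / 3 < th' < pi ->
  conj_pair a 1 th z -> conj_pair a 1 th' z' -> th < th' -> z < z'.
Proof.
move=> u0 aE hI hI' cz cz' tt; have p0 : 0 < pi :> R := pi_gt0 R.
case: (ltgtP z z') => // zz.
  by have := conj_pair1_mono u0 aE hI' hI cz' cz zz; rewrite ltNge (ltW tt).
move: tt; rewrite zz in cz; rewrite (@conj_pair_inj R a 1 th th' z') ?ltxx //.
  by move/andP: hI => [? ?]; apply/andP; split; lra.
by move/andP: hI' => [? ?]; apply/andP; split; lra.
Qed.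

(** With n = [m %/ 3], the interval (2 pi / 3, pi) contains n + 1 of the angles if m = 3 n + 2,
    enough for n sign changes. Otherwise it contains n, and the sign near -oo, read off the top
    coefficient, supplies the last change. *)
Lemma H1_roots (R : realType) (a u : R) (m : nat) :
  0 <= u <= 2 -> a = (1 - u ^+ 2) / 3 -> exists rs : seq R,
  [/\ size rs = (m %/ 3)%N, uniq rs, all (root (H a 1 m)) rs &
      forall r, r \in rs -> r < (-2 + 9 * a - 2 * u ^+ 3) / 27].
Proof.
move=> /andP[u0 u2] aE; set zmax := (_ / 27).
have aI : -1 <= a <= 3^-1.
  have u4 : u ^+ 2 <= 4 by nra.
  by have := sqr_ge0 u; rewrite aE => ?; apply/andP; split; lra.
have p0 : 0 < pi :> R := pi_gt0 R.
have [m3|m3] := ltnP m 3; first by exists [::]; split=> //=; rewrite divn_small.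
have [f fP] := @conj_pair_points R a 1 (2 * pi / 3) pi m
  (fun th => @conj_pair1_exists R a th aI).
have fK k : (2 * m.+2 < 3 * k < 3 * m.+2)%N ->
    (2 * pi / 3 : R) < k%:R * pi / m.+2%:R < (pi : R) /\
    conj_pair a 1 (k%:R * pi / m.+2%:R) (f k).
  move=> kI; have := @angle_range R 2 3 k m kI.
  have -> : 3 * pi / 3 = pi :> R by field.
  by move=> tI; split=> //; exact: fP.
have mono k : (2 * m.+2 < 3 * k)%N -> (3 * k.+1 < 3 * m.+2)%N -> f k < f k.+1.
  move=> k1 k2.
  have [|t1 c1] := fK k; first lia.
  have [|t2 c2] := fK k.+1; first lia.
  apply: (conj_pair1_incr u0 aE t1 t2 c1 c2); exact: angle_ltS.
have sgn k : (2 * m.+2 < 3 * k < 3 * m.+2)%N -> 0 < (-1) ^+ k.+1 * (H a 1 m).[f k].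
  by move=> kI; have [_ c1] := fK k kI; apply: H_sign c1; lia.
have fmax k : (2 * m.+2 < 3 * k < 3 * m.+2)%N -> f k < zmax.
  by move=> kI; have [t1 c1] := fK k kI; exact: conj_pair1_lt c1.
pose n := (m %/ 3)%N.
have par (i j : nat) : odd i = odd j -> (-1) ^+ i = (-1) ^+ j :> R.
  by move=> ij; rewrite -signr_odd ij signr_odd.
have [mE|mE] : m = (3 * n).+2 \/ (m < (3 * n).+2)%N by rewrite /n; lia.
  have [i iN|i iN|rs [sz un rt bd]] :=
    @roots_of_sign_changes R (H a 1 m) (fun i => f ((2 * n).+3 + i)%N) 0 n.
  - by rewrite addnS; apply: mono; lia.
  - rewrite (par _ ((2 * n).+3 + i).+1); last by lia.
    by apply: sgn; lia.
  exists rs; split=> // r /bd /andP[_ /lt_trans]; apply; apply: fmax; lia.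
(* [k0] is the least admissible index, and [e] is m - 3 n. The sign at [f k0] is (-1)^(e+1),
   opposite to the sign (-1)^e near -oo. *)
pose k0 := if m == (3 * n)%N then (2 * n).+2 else (2 * n).+3.
pose e := if m == (3 * n)%N then 0%N else 1%N.
have [y yk ys] : exists2 y, y < f k0 & 0 < (-1) ^+ e * (H a 1 m).[y].
  apply: (@sign_at_minfty R _ n); first exact: size_H.
  have [A B _] := coef_H_top R a 1 n; rewrite /e; case: eqP => m3n.
    by rewrite m3n A addn0 -expr2 sqrr_sign.
  have -> : m = (3 * n).+1 by move: m3n mE; rewrite /n; lia.
  rewrite B addn1 exprS.
  have -> : -1 * (-1) ^+ n * (- (-1) ^+ n * 1 * n.+1%:R) =
    ((-1) ^+ n) ^+ 2 * n.+1%:R :> R by ring.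
  by rewrite sqrr_sign mul1r ltr0n.
have k0E : (k0 = (2 * n).+2 + e)%N by rewrite /k0 /e; case: eqP; lia.
have mE' : m = (3 * n + e)%N by rewrite /e; case: eqP; move: mE; rewrite /n; lia.
have e1 : (e <= 1)%N by rewrite /e; case: eqP.
have [i iN|i iN|rs [sz un rt bd]] := @roots_of_sign_changes R (H a 1 m)
  (fun i => if i is j.+1 then f (k0 + j)%N else y) e n.
- by case: i iN => [|i] iN; [rewrite addn0 | rewrite addnS; apply: mono; lia].
- case: i iN => [|i] iN //.
  rewrite (par _ (k0 + i).+1); last by lia.
  by apply: sgn; lia.
exists rs; split=> // r /bd /andP[_ /lt_trans]; apply.
have n0 : (0 < n)%N by rewrite /n; lia.
by rewrite -(prednK n0); apply: fmax; lia.
Qed.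

Lemma H_scaled_roots (R : realType) (b c u : R) (m : nat) : c != 0 ->
  0 <= u <= 2 -> b / c ^+ 2 = (1 - u ^+ 2) / 3 -> exists rs : seq R,
  [/\ size rs = (m %/ 3)%N, uniq rs, all (root (H b c m)) rs &
      forall r, r \in rs ->
        r / c ^+ 3 < (-2 + 9 * (b / c ^+ 2) - 2 * u ^+ 3) / 27].
Proof.
move=> c0 uI aE; have [rs [sz un /allP rt bd]] := H1_roots m uI aE.
have c3 : c ^+ 3 != 0 by rewrite expf_neq0.
exists [seq c ^+ 3 * x | x <- rs]; split.
- by rewrite size_map.
- by rewrite map_inj_uniq //; exact: mulfI.
- apply/allP => _ /mapP[x /rt /rootP xr ->]; apply/rootP.
  by rewrite H_scale // xr mulr0.
- by move=> _ /mapP[x /bd xr ->]; rewrite mulrAC divff // mul1r.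
Qed.

(** * Density of the zeros *)

Lemma closure_realP (R : realType) (A : set R) (y : R) :
  (forall e, 0 < e -> exists2 r, A r & y - e < r < y + e) -> closure A y.
Proof.
move=> H B /nbhs_ballP[e /= e0 eB]; have [r Ar rI] := H e e0.
exists r; split=> //; apply: eB; rewrite /ball /= ltr_distlC.
exact: rI.
Qed.

Lemma closure_union_zeros0 (R : realType) (b : R) :
  0 < b -> closure (union_zeros b 0) = setT.
Proof.
move=> b0; have p0 : 0 < pi :> R := pi_gt0 R.
apply/seteqP; split=> // y _; apply: closure_realP => e e0.
have [ta taI ca] := conj_pair0_surj (y - e) b0.
have [tb tbI cb] := conj_pair0_surj y b0.
have rng (th : R) : pi / 3 < th < 2 * pi / 3 -> 0 < th < pi.
  by move=> /andP[? ?]; apply/andP; split; lra.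
have yy : y - e < y by lra.
have tt := conj_pair0_mono b0 (rng _ taI) (rng _ tbI) ca cb yy.
have sub (th : R) : tb < th < ta -> pi / 3 < th < 2 * pi / 3.
  move: taI tbI => /andP[? ?] /andP[? ?] /andP[? ?]; apply/andP; split; lra.
have [|||th /sub thI|th z thI cz|r ur /andP[r1 r2]] :=
  @exists_zero_between R b 0 tb ta (y - e) y.
- by move/andP: tbI => [? ?]; lra.
- exact: tt.
- by move/andP: taI => [? ?]; lra.
- exact: conj_pair0_exists.
- have thR := rng _ (sub _ thI); move/andP: thI => [h1 h2].
  by rewrite (conj_pair0_anti b0 (rng _ taI) thR ca cz h2)
    (conj_pair0_anti b0 thR (rng _ tbI) cz cb h1).
by exists r => //; apply/andP; split; lra.
Qed.

Lemma zeros_dense1 (R : realType) (a u y e : R) :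
  0 <= u <= 2 -> a = (1 - u ^+ 2) / 3 -> 0 < e ->
  y <= (-2 + 9 * a - 2 * u ^+ 3) / 27 ->
  exists2 r, union_zeros a 1 r & y - e < r < y.
Proof.
move=> uI aE e0 yu; have p0 : 0 < pi :> R := pi_gt0 R.
have [u0 u2] := andP uI.
have aI : -1 <= a <= 3^-1.
  have u4 : u ^+ 2 <= 4 by nra.
  by have := sqr_ge0 u; rewrite aE => ?; apply/andP; split; lra.
have ya : y - e < (-2 + 9 * a - 2 * u ^+ 3) / 27 by lra.
(* Aiming at (y - e, y - e/2) keeps both ends strictly below the endpoint, even when y equals it. *)
have yb : y - e / 2 < (-2 + 9 * a - 2 * u ^+ 3) / 27 by lra.
have [ta taI ca] := conj_pair1_surj uI aE ya.
have [tb tbI cb] := conj_pair1_surj uI aE yb.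
have yy : y - e < y - e / 2 by lra.
have tt := conj_pair1_mono u0 aE taI tbI ca cb yy.
have sub (th : R) : ta < th < tb -> 2 * pi / 3 < th < pi.
  move: taI tbI => /andP[? ?] /andP[? ?] /andP[? ?]; apply/andP; split; lra.
have [|||th /sub thI|th z thI cz|r ur /andP[r1 r2]] :=
  @exists_zero_between R a 1 ta tb (y - e) (y - e / 2).
- by move/andP: taI => [? ?]; lra.
- exact: tt.
- by move/andP: tbI => [? ?]; lra.
- exact: conj_pair1_exists.
- have thR := sub _ thI; move/andP: thI => [h1 h2].
  by rewrite (conj_pair1_incr u0 aE taI thR ca cz h1)
    (conj_pair1_incr u0 aE thR tbI cz cb h2).
by exists r => //; apply/andP; split; lra.
Qed.

Lemma union_zeros_scale (R : realType) (b c x : R) : c != 0 ->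
  union_zeros (b / c ^+ 2) 1 x -> union_zeros b c (c ^+ 3 * x).
Proof.
move=> c0 [m [h0 /rootP hx]]; exists m; split; last first.
  by apply/rootP; rewrite H_scale // hx mulr0.
apply: contraNneq h0 => h0; have := H_comp_scale b m c0.
rewrite h0 comp_poly0 => /esym/eqP.
by rewrite scaler_eq0 expf_eq0 (negPf c0) andbF.
Qed.

(** Taking u = sqrt (1 - 3 b / c^2) turns the radical into u^3 and the range of b / c^2 into 0 <= u
    <= 2. *)
Lemma ratio_discriminant (R : realType) (b c : R) :
  -1 <= b / c ^+ 2 <= 3^-1 -> exists u, [/\ 0 <= u <= 2,
    b / c ^+ 2 = (1 - u ^+ 2) / 3 &
    Num.sqrt ((1 - 3 * (b / c ^+ 2)) ^+ 3) = u ^+ 3].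
Proof.
move: (b / _) => a /andP[a1 a2]; pose u := Num.sqrt (1 - 3 * a).
have uE : u ^+ 2 = 1 - 3 * a by rewrite sqr_sqrtr //; lra.
have u0 : 0 <= u by rewrite sqrtr_ge0.
exists u; split.
- rewrite u0 -(@ler_pXn2r _ 2) ?nnegrE // uE; lra.
- by rewrite uE; field.
- by rewrite -uE -exprM mulnC exprM sqrtr_sqr ger0_norm // exprn_ge0.
Qed.

Lemma closure_union_zeros1 (R : realType) (b c : R) : c != 0 ->
  -1 <= b / c ^+ 2 <= 3^-1 ->
  closure (union_zeros b c) =
  [set c ^+ 3 * x | x in [set x : R | x <= (-2 + 9 * (b / c ^+ 2)
    - 2 * Num.sqrt ((1 - 3 * (b / c ^+ 2)) ^+ 3)) / 27]].
Proof.
move=> c0 /ratio_discriminant[u [uI aE ->]].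
set zmax := (_ / 27); have c3 : c ^+ 3 != 0 by rewrite expf_neq0.
have cl : closed [set y : R | y / c ^+ 3 <= zmax].
  have -> : [set y : R | y / c ^+ 3 <= zmax] =
    (fun y => y / c ^+ 3) @^-1` [set x | x <= zmax] by [].
  apply: preimage_closed; last exact: closed_le.
  by move=> y _; exact: mulrr_continuous.
apply/seteqP; split.
  (* The roots constructed exhaust the degree, so every zero is among them and obeys their bound. *)
  have sub : union_zeros b c `<=` [set y : R | y / c ^+ 3 <= zmax].
    move=> r [m [h0 hr]] /=; have [rs [sz un rt bd]] := H_scaled_roots m c0 uI aE.
    by apply/ltW/bd; apply: root_mem_of_size hr => //; rewrite sz size_H.
  move=> y /(closureS sub) /cl /= yz.
  by exists (y / c ^+ 3) => //; rewrite mulrC divfK.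
move=> _ [x /= xz <-]; apply: closure_realP => e e0.
have c30 : 0 < `|c ^+ 3| by rewrite normr_gt0.
have e1 : 0 < e / `|c ^+ 3| by rewrite divr_gt0.
have [r ur /andP[r1 r2]] := zeros_dense1 uI aE e1 xz.
exists (c ^+ 3 * r); first exact: union_zeros_scale.
rewrite -ltr_distlC -mulrBr normrM mulrC -ltr_pdivlMr // gtr0_norm; lra.
Qed.

Unset Implicit Arguments.

Theorem theorem1p1 (R : realType) (b c : R) :
  ((forall m : nat, zeros_real (H b c m)) <->
     ((c = 0 /\ 0 <= b) \/ (c != 0 /\ -1 <= b / c ^+ 2 <= 3^-1)))
  /\ (c = 0 -> 0 < b -> closure (union_zeros b c) = setT)
  /\ (c != 0 -> -1 <= b / c ^+ 2 <= 3^-1 ->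
        closure (union_zeros b c) =
        [set c ^+ 3 * x | x in
          [set x : R | x <= (-2 + 9 * (b / c ^+ 2)
                             - 2 * Num.sqrt ((1 - 3 * (b / c ^+ 2)) ^+ 3)) / 27]]).
Proof.
split; last by split=> [->|]; [exact: closure_union_zeros0 | exact: closure_union_zeros1].
split=> [|[[-> b0]|[c0 aI]] m]; first exact: real_zeros_necessary.
  exact: zeros_real_H0.
have [u [uI aE _]] := ratio_discriminant aI.
have [rs [sz un rt _]] := H_scaled_roots m c0 uI aE.
by apply: (zeros_real_of_roots un rt); rewrite sz leqW // size_H.
Qed.
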